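(* Let $k\in\{1,2\}$. For every continuous strong $k$-Dini gauge $\mathsf{u}$ on $(k+1)$-simplices in $D$ such that the germ $\tilde{\mathsf{u}}$ defined by $\langle S,\tilde{\mathsf{u}}\rangle:=\sum_{n=0}^{\infty}2^{nk}\langle (2^{-n})_\natural S,\mathsf{u}\rangle$ is continuous, there exists a continuous $k$-Dini gauge $\mathsf{v}$ on $k$-simplices in $D$ such that the following holds: if a $k$-germ $\omega$ in $D$ is continuous, nonatomic and $\delta\omega\approx_{\mathsf{u}}0$, then $\omega$ is $\mathsf{v}$-sewable, with $\operatorname{sew}\omega$ continuous and $$[\omega-\operatorname{sew}\omega]_{\mathsf{v}}\le[\delta\omega]_{\mathsf{u}}.$$
   Context: Let $D\subseteq\mathbb{R}^d$ be a set. A $k$-simplex in $D$ is a tuple $S=[p_0p_1\ldots p_k]\in D^{k+1}$ with $\operatorname{conv}(S)\subseteq D$; $\operatorname{Simp}^k(D)$ is the set of $k$-simplices, and $\operatorname{Chain}^k(D)$ the real vector space generated by them. A $k$-germ in $D$ is a function $\omega:\operatorname{Simp}^k(D)\to\mathbb{R}$, written $\omega_S=\langle S,\omega\rangle$ and extended linearly to chains. It is continuous if $\omega_{S^n}\to\omega_S$ whenever the vertices of $S^n$ converge to those of $S$. The boundary is $\partial[p_0\ldots p_k]=\sum_{i=0}^k(-1)^i[p_0\ldots\hat p_i\ldots p_k]$, and $\langle S,\delta\omega\rangle:=\langle\partial S,\omega\rangle$ for $S\in \operatorname{Simp}^{k+1}(D)$. For $S=[p_0\ldots p_k]$, $\operatorname{vol}_k(S)=\frac1{k!}\sqrt{\det(PP^T)}$,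 where $P$ is the matrix with rows $p_i-p_0$, $i=1,\dots,k$. A $k$-germ $\omega$ is nonatomic if $\omega_S=0$ whenever $\operatorname{vol}_k(S)=0$; it is closed on $k$-planes if for every affine $\varphi:I\subseteq\mathbb{R}^k\to D$ the germ $S\mapsto\omega_{\varphi_\natural S}$ on $\operatorname{Simp}^k(I)$ has $\delta$ equal to $0$, where $\varphi_\natural[p_0\ldots p_k]=[\varphi(p_0)\ldots\varphi(p_k)]$; it is regular if it is nonatomic and closed on $k$-planes. A $k$-gauge is a nonnegative $k$-germ $\mathsf{v}$; it is uniform if it takes equal values on $k$-simplices $S,S'$ in $D$ that are isometric, i.e. there is an isometry of $\mathbb{R}^d$ mapping the $j$-th vertex of $S$ to the $j$-th vertex of $S'$ for all $j$. $[\omega]_{\mathsf{v}}\in[0,\infty]$ is the infimum of constants $c\ge 0$ with $|\omega_S|\le c\,\mathsf{v}_S$ for all $S$; $\omega\approx_{\mathsf{v}}\tilde\omega$ means $[\omega-\tilde\omega]_{\mathsf{v}}<\infty$. $(\lambda)_\natural S$ is the image of $S$ under $x\mapsto\lambda x$; for a uniform gauge $\langle(2^{-n})_\natural S,\mathsf{u}\rangle$ is understood as the value on any translated copy of $(2^{-n})_\natural S$ contained in $D$. A gauge $\mathsf{u}$ is $r$-Dini ($r\ge0$) if it is uniform and $\lim_{n\to\infty}2^{nr}\langle(2^{-n})_\natural S,\mathsf{u}\rangle=0$ for every simplex $S$ (of the relevant dimension) in $D$; it is strong $r$-Dini if in addition $\sum_{n\ge0}2^{nr}\langle(2^{-n})_\natural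 S,\mathsf{u}\rangle<\infty$ for every $S$. A $k$-germ $\omega$ is $\mathsf{v}$-sewable, for a $k$-Dini $k$-gauge $\mathsf{v}$, if there exists a regular $k$-germ $\operatorname{sew}\omega$ with $\omega\approx_{\mathsf{v}}\operatorname{sew}\omega$ (for $k\in\{1,2\}$ such a germ is unique, also independently of the choice of $\mathsf{v}$). *)

(* Defs.v *)
From HB Require Import structures.
From mathcomp Require Import all_boot all_order all_algebra.
From mathcomp Require Import all_classical all_reals all_analysis.

Set Implicit Arguments.
Unset Strict Implicit.
Unset Printing Implicit Defensive.

Import Order.TTheory GRing.Theory Num.Theory.
Import numFieldNormedType.Exports.

Local Open Scope classical_set_scope.
Local Open Scope ring_scope.

(* A tuple [p_0 ... p_k] of points of R^d is the matrix whose i-th row is p_i,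
   so convergence of matrices is convergence of all the vertices. *)
Notation tuple_of R k d := 'M[R]_(k.+1, d).

Definition conv_hull (R : realType) (m d : nat) (S : 'M[R]_(m, d)) :
    set 'rV[R]_d :=
  [set x | exists a : 'rV[R]_m,
    [/\ forall i, 0 <= a 0 i, \sum_i a 0 i = 1 & x = a *m S]].

(* The vertices belong to their convex hull, hence to D. *)
Definition simplex (R : realType) (k d : nat) (D : set 'rV[R]_d)
    (S : tuple_of R k d) : Prop :=
  conv_hull S `<=` D.

(* A germ in D is represented by a function on all tuples; every notion below
   only looks at its values on simplices in D. *)
Definition germ (R : realType) (k d : nat) : Type := tuple_of R k d -> R.

Definition germ_continuous (R : realType) (k d : nat) (D : set 'rV[R]_d)
    (w : germ R k d) : Prop :=
  forall (Sn : nat -> tuple_of R k d) (S : tuple_of R k d),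
    (forall n, simplex D (Sn n)) -> simplex D S ->
    Sn @ \oo --> S -> (fun n => w (Sn n)) @ \oo --> w S.

(* <S, delta w> = <boundary S, w>; the i-th face omits the i-th row. *)
Definition delta (R : realType) (k d : nat) (w : germ R k d) :
    germ R k.+1 d :=
  fun S => \sum_(i < k.+2) (-1) ^+ i * w (row' i S).

Definition edge_mx (R : realType) (k d : nat) (S : tuple_of R k d) :
    'M[R]_(k, d) :=
  \matrix_(i < k) (row (lift ord0 i) S - row ord0 S).

Definition vol (R : realType) (k d : nat) (S : tuple_of R k d) : R :=
  (k`!%:R)^-1 * Num.sqrt (\det (edge_mx S *m (edge_mx S)^T)).

Definition nonatomic (R : realType) (k d : nat) (D : set 'rV[R]_d)
    (w : germ R k d) : Prop :=
  forall S, simplex D S -> vol S = 0 -> w S = 0.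

Definition map_vertices (R : realType) (k m d : nat)
    (phi : 'rV[R]_m -> 'rV[R]_d) (S : tuple_of R k m) : tuple_of R k d :=
  \matrix_(i < k.+1) phi (row i S).

Definition affine_on (R : realType) (m d : nat) (I : set 'rV[R]_m)
    (phi : 'rV[R]_m -> 'rV[R]_d) : Prop :=
  exists (A : 'M[R]_(m, d)) (b : 'rV[R]_d),
    forall x, I x -> phi x = x *m A + b.

Definition closed_on_planes (R : realType) (k d : nat) (D : set 'rV[R]_d)
    (w : germ R k d) : Prop :=
  forall (I : set 'rV[R]_k) (phi : 'rV[R]_k -> 'rV[R]_d),
    affine_on I phi -> (forall x, I x -> D (phi x)) ->
    forall S : tuple_of R k.+1 k, simplex I S ->
      delta (fun T : tuple_of R k k => w (map_vertices phi T)) S = 0.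

Definition regular_germ (R : realType) (k d : nat) (D : set 'rV[R]_d)
    (w : germ R k d) : Prop :=
  nonatomic D w /\ closed_on_planes D w.

Definition is_gauge (R : realType) (k d : nat) (D : set 'rV[R]_d)
    (v : germ R k d) : Prop :=
  forall S, simplex D S -> 0 <= v S.

(* The library norm on row vectors is the sup norm, hence this definition. *)
Definition eucl_dist (R : realType) (d : nat) (x y : 'rV[R]_d) : R :=
  Num.sqrt (\sum_(i < d) (x 0 i - y 0 i) ^+ 2).

Definition isometric (R : realType) (k d : nat) (S S' : tuple_of R k d) :
    Prop :=
  exists f : 'rV[R]_d -> 'rV[R]_d,
    (forall x y, eucl_dist (f x) (f y) = eucl_dist x y) /\
    (forall j, f (row j S) = row j S').

Definition uniform_gauge (R : realType) (k d : nat) (D : set 'rV[R]_d)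
    (v : germ R k d) : Prop :=
  is_gauge D v /\
  forall S S', simplex D S -> simplex D S' -> isometric S S' -> v S = v S'.

(* [w]_v in [0, +oo]; the infimum of the empty set is +oo. *)
Definition germ_seminorm (R : realType) (k d : nat) (D : set 'rV[R]_d)
    (v w : germ R k d) : \bar R :=
  ereal_inf [set c%:E | c in [set c : R | 0 <= c /\
    forall S, simplex D S -> `|w S| <= c * v S]].

Definition germ_approx (R : realType) (k d : nat) (D : set 'rV[R]_d)
    (v w w' : germ R k d) : Prop :=
  (germ_seminorm D v (w \- w')%R < +oo)%E.

Definition translate (R : realType) (k d : nat) (b : 'rV[R]_d)
    (S : tuple_of R k d) : tuple_of R k d :=
  \matrix_(i < k.+1) (row i S + b).

(* The translated copy of the image of S under x |-> 2^-n x that has the same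
   initial vertex as S. It lies in D when S does (shrink_simplex), and a uniform
   gauge takes the same value on every other translated copy in D
   (uniform_shrink). *)
Definition shrink (R : realType) (k d n : nat) (S : tuple_of R k d) :
    tuple_of R k d :=
  translate ((1 - 2 ^- n) *: row ord0 S) (2 ^- n *: S).

Definition dini_term (R : realType) (k d : nat) (r : R) (u : germ R k d)
    (S : tuple_of R k d) (n : nat) : R :=
  2 `^ (n%:R * r) * u (shrink n S).

Definition dini (R : realType) (k d : nat) (D : set 'rV[R]_d) (r : R)
    (u : germ R k d) : Prop :=
  uniform_gauge D u /\
  forall S, simplex D S -> dini_term r u S @ \oo --> (0 : R).

(* The terms are nonnegative, so finiteness of the sum is convergence. *)
Definition strong_dini (R : realType) (k d : nat) (D : set 'rV[R]_d) (r : R)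
    (u : germ R k d) : Prop :=
  dini D r u /\
  forall S, simplex D S -> cvgn (series (dini_term r u S)).

Definition dini_sum (R : realType) (k d : nat) (r : R) (u : germ R k d) :
    germ R k d :=
  fun S => limn (series (dini_term r u S)).

Definition is_sewing (R : realType) (k d : nat) (D : set 'rV[R]_d)
    (v w eta : germ R k d) : Prop :=
  regular_germ D eta /\ germ_approx D v w eta.

Lemma shrink_simplex (R : realType) (k d n : nat) (D : set 'rV[R]_d)
    (S : tuple_of R k d) : simplex D S -> simplex D (shrink n S).
Proof.
move=> DS x [a [a0 a1 ->]]; apply: DS.
have e0 : 0 <= 2 ^- n :> R by rewrite invr_ge0 exprn_ge0.
have e1 : 2 ^- n <= 1 :> R.
  by rewrite invf_le1 ?exprn_gt0// exprn_ege1// ler1n.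
exists (2 ^- n *: a + (1 - 2 ^- n) *: delta_mx 0 ord0); split.
- move=> i; rewrite !mxE addr_ge0 ?mulr_ge0// ?subr_ge0//.
- under eq_bigr do rewrite !mxE.
  rewrite big_split /= -!mulr_sumr a1 (bigD1 ord0)//= big1.
    by rewrite addr0 !mulr1 addrC subrK.
  by move=> i /negbTE ->.
apply/rowP => j; rewrite mulmxDl -!scalemxAl -rowE !mxE.
under eq_bigr do rewrite !mxE mulrDr.
rewrite big_split /= -mulr_suml a1 mul1r; congr (_ + _).
by rewrite mulr_sumr; apply: eq_bigr => i _; rewrite mulrCA.
Qed.

Lemma uniform_shrink (R : realType) (k d n : nat) (D : set 'rV[R]_d)
    (u : germ R k d) (S : tuple_of R k d) (b : 'rV[R]_d) :
  uniform_gauge D u -> simplex D S -> simplex D (translate b (2 ^- n *: S)) ->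
  u (translate b (2 ^- n *: S)) = u (shrink n S).
Proof.
move=> [_ uu] DS Db; apply: uu => //; first exact: shrink_simplex.
exists (fun x => x - b + (1 - 2 ^- n) *: row ord0 S); split.
  move=> x y; rewrite /eucl_dist; congr Num.sqrt; apply: eq_bigr => i _.
  by rewrite !mxE opprD addrACA subrr addr0 opprD addrACA subrr addr0.
by move=> j; apply/rowP => i; rewrite !mxE addrK.
Qed.

(* Main.v *)
Require Import Defs.
From mathcomp Require Import all_boot all_order all_algebra.
From mathcomp Require Import all_classical all_reals all_analysis.
From mathcomp Require Import zify ring lra.
Import Order.TTheory GRing.Theory Num.Theory.
Import numFieldNormedType.Exports.
Local Open Scope classical_set_scope.
Local Open Scope ring_scope.

(** Write T m for the m-th term 2^(mk) <(2^-m) T, u> of the Dini series of a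
    (k+1)-simplex T.  Cut a k-simplex S into 2^k halves of S (a segment at its
    midpoint, a triangle along its three mid-lines) and let [subdivide w S] be
    the sum of the values of w on the pieces.  As w vanishes on degenerate
    simplices, w S - [subdivide w S] is a signed sum of values of [delta w] on
    finitely many (k+1)-simplices whose vertices are midpoints of vertices of S
    ([defect1_le_fills], [defect2_le_fills]).  If |delta w| <= c u, then, u being
    uniform, the n-th subdivision differs from the next one by at most c times a
    sum of n-th Dini terms.  So the iterated subdivisions converge; the limit is
    [sew w], and the gauge v is the sum of the full Dini sums of the filling
    simplices.  It is a k-Dini gauge because v of (2^-n) S, multiplied by 2^(nk),
    is a sum of tails of convergent series.

    The delicate point is that the limit g is closed on k-planes, although the
    construction only makes it invariant under dyadic subdivision.  Two facts
    are combined.  First, on simplices contained in one fixed simplex the tails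
    of the Dini series go to 0 uniformly, by Dini's theorem on a compact set
    ([tail_uniform]); hence |delta g| <= e 2^(-nk) on all coplanar (k+1)-simplices
    of size 2^-n inside a fixed k-simplex, once n is large ([delta_sew_small]).
    Secondly, g has approximate primitives in coordinates of that k-simplex: there
    is a (k-1)-germ l such that g and the coboundary of l differ by O(e) 2^(-nk) on
    the k-simplices of size 2^-n.  Subdividing n times multiplies the difference by
    2^(nk); it fixes g, and turns the coboundary of l into another coboundary.  So
    g is a uniform limit of coboundaries, and delta g = 0 ([line_closed],
    [triangle_closed]).

    For k = 2 the primitive is integrated along a discrete homotopy of the
    triangle 0 <= y <= x <= 1 to its bottom side: a point is first rounded down to
    the grid of mesh 2^-n, and then moves down its grid column one step at a time.
    Three nearby points lie in at most two adjacent columns.  Hence two of the three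
    columns coincide while the homotopy goes down, and the prism that it sweeps
    has two equal sides, so it contributes nothing: of the roughly 2^n prisms only
    two near the top matter, and each of them is a union of three small tetrahedra.

    This handles simplices inside a segment or a triangle.  Four points of a plane
    may form a convex quadrilateral; by Radon's argument two of the lines through
    complementary pairs of points cross at a point x of their hull, and delta delta = 0
    expresses delta g on the four points by its values on four tuples that contain x
    and three collinear points, whose hulls are triangles ([closed_on_2planes]). *)

Set Implicit Arguments.
Unset Strict Implicit.
Unset Printing Implicit Defensive.

Local Notation tuple_of R k d := 'M[R]_(k.+1, d).

(** * One real variable: grids, and germs on segments of the line *)

(** Used for homotopies all of whose steps but one sweep degenerate simplices. *)
Lemma norm_sum_single (R : realDomainType) (F : nat -> R) (j n : nat) (e : R) :
  0 <= e -> (forall i, (i < n)%N -> i != j -> F i = 0) ->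
  ((j < n)%N -> `|F j| <= e) -> `|\sum_(i < n) F i| <= e.
Proof.
move=> e0; elim: n => [|n IH] F0 Fj; first by rewrite big_ord0 normr0.
rewrite big_ord_recr /=; have [nj|nj] := eqVneq n j.
  rewrite big1 ?add0r; first by rewrite nj Fj // -nj.
  move=> i _; apply: F0; first exact: leqW (ltn_ord i).
  by rewrite -nj neq_ltn ltn_ord.
rewrite [F n]F0 // addr0; apply: IH => [i ilt|jlt]; first by apply: F0; apply: leqW.
by apply: Fj; apply: leqW.
Qed.

(** The cells of nearby points are adjacent, so that one step above the lower cell
    both points stand still. *)
Lemma above_min (a b k : nat) : (a <= b.+1)%N -> (b <= a.+1)%N ->
  k != minn a b -> (minn a b <= k)%N -> (a <= k)%N /\ (b <= k)%N.
Proof. by lia. Qed.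

Lemma eq0_small_norm (R : realFieldType) (x C : R) : 0 < C ->
  (forall e, 0 < e -> `|x| <= C * e) -> x = 0.
Proof.
move=> C0 H; apply/eqP; rewrite -normr_le0; apply/ler_addgt0Pr => e e0.
rewrite add0r; have := H (e / C) (divr_gt0 e0 C0).
by rewrite mulrCA divff ?gt_eqF// mulr1.
Qed.

Section Grid.
Variables (R : realType) (N : nat).
Hypothesis N0 : (0 < N)%N.
Implicit Types (x y : R).

Definition cell x : nat := Num.truncn (x * N%:R).

Definition node (i : nat) : R := i%:R / N%:R.

Let NR : 0 < N%:R :> R. Proof. by rewrite ltr0n. Qed.

Lemma node_cell_le x : 0 <= x -> node (cell x) <= x.
Proof.
move=> x0; rewrite /node ler_pdivrMr //.
by have /andP[] := truncn_itv (mulr_ge0 x0 (ltW NR)).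
Qed.

Lemma lt_node_cell x : 0 <= x -> x < node (cell x) + N%:R^-1.
Proof.
move=> x0; rewrite /node -[X in _ + X]mul1r -mulrDl ltr_pdivlMr // natr1.
by have /andP[] := truncn_itv (mulr_ge0 x0 (ltW NR)).
Qed.

Lemma cell_le x y : 0 <= x -> x <= y -> (cell x <= cell y)%N.
Proof. by move=> x0 xy; apply: le_truncn; rewrite ler_pM2r. Qed.

Lemma cell_le1 x : 0 <= x -> x <= 1 -> (cell x <= N)%N.
Proof.
move=> x0 x1; rewrite -(ler_nat R); have := node_cell_le x0.
by rewrite /node ler_pdivrMr // => /le_trans -> //; rewrite ler_piMl // ltW.
Qed.

Lemma cell_close x y : 0 <= x -> 0 <= y -> `|x - y| <= N%:R^-1 ->
  (cell x <= (cell y).+1)%N.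
Proof.
move=> x0 y0 xy; rewrite -ltnS -(ltr_nat R).
have := node_cell_le x0; have := lt_node_cell y0; rewrite /node.
rewrite -[X in _ + X]mul1r -mulrDl ltr_pdivlMr // ler_pdivrMr // => h1 h2.
have h3 : (x - y) * N%:R <= 1.
  by rewrite -ler_pdivlMr // mul1r (le_trans _ xy) // ler_norm.
rewrite -[(cell y).+2]addn2 natrD; nra.
Qed.

Lemma node_ge0 i : 0 <= node i.
Proof. by rewrite divr_ge0. Qed.

Lemma node_le i j : (i <= j)%N -> node i <= node j.
Proof. by move=> ij; rewrite ler_pM2r ?invr_gt0 // ler_nat. Qed.

Lemma nodeS i : node i.+1 = node i + N%:R^-1.
Proof. by rewrite /node -natr1 mulrDl mul1r. Qed.

Lemma node_close i j : (i <= j.+1)%N -> (j <= i.+1)%N ->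
  `|node i - node j| <= N%:R^-1.
Proof.
move=> /node_le ij /node_le ji; rewrite ler_norml; rewrite !nodeS in ij ji.
by apply/andP; split; lra.
Qed.

(** The homotopy from the identity to 0: at time N.+1 a point is where it was, at
    time N it has been rounded down to the grid, and at time k <= N it has gone
    down to the k-th node if it was above it. *)
Definition stage (k : nat) x : R :=
  if (k <= N)%N then node (minn (cell x) k) else x.

Lemma stage0 x : stage 0 x = 0.
Proof. by rewrite /stage leq0n minn0 /node mul0r. Qed.

Lemma stage_last x : stage N.+1 x = x.
Proof. by rewrite /stage ltnn. Qed.

Lemma stage_low k x : (k <= N)%N -> (k <= cell x)%N -> stage k x = node k.
Proof. by move=> kN kx; rewrite /stage kN (minn_idPr kx). Qed.

Lemma stage_high k x : (k <= N)%N -> (cell x <= k)%N -> stage k x = node (cell x).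
Proof. by move=> kN kx; rewrite /stage kN (minn_idPl kx). Qed.

Lemma stage_ge0 k x : 0 <= x -> 0 <= stage k x.
Proof. by rewrite /stage; case: ifP => // _ _; apply: node_ge0. Qed.

Lemma stage_le k x : 0 <= x -> stage k x <= x.
Proof.
move=> x0; rewrite /stage; case: ifP => // _.
exact: le_trans (node_le (geq_minl _ _)) (node_cell_le x0).
Qed.

Lemma node_point_close x y : 0 <= x -> 0 <= y -> `|x - y| <= N%:R^-1 ->
  [/\ `|node (cell x) - node (cell y)| <= 2 * N%:R^-1, `|x - y| <= 2 * N%:R^-1 &
      `|node (cell x) - y| <= 2 * N%:R^-1].
Proof.
move=> x0 y0 xy; have h0 : 0 < N%:R^-1 :> R by rewrite invr_gt0.
have yx : `|y - x| <= N%:R^-1 by rewrite distrC.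
have := node_close (cell_close x0 y0 xy) (cell_close y0 x0 yx).
have := node_cell_le x0; have := lt_node_cell x0; move: xy; clear yx.
move: (node (cell x)) (node (cell y)) => a b; rewrite !ler_norml.
by move=> /andP[? ?] ? ? /andP[? ?]; split; apply/andP; split; lra.
Qed.

(** During the step from time k to time k.+1 nearby points stay near each other,
    and near their former positions. *)
Lemma stage_close x y k i j : 0 <= x <= 1 -> 0 <= y <= 1 -> `|x - y| <= N%:R^-1 ->
  k = N \/ [/\ (k < N)%N, (k <= cell x)%N & (k <= cell y)%N] ->
  (k <= i <= k.+1)%N -> (k <= j <= k.+1)%N ->
  `|stage i x - stage j y| <= 2 * N%:R^-1.
Proof.
move=> /andP[x0 x1] /andP[y0 y1] xy kP iP jP.
have yx : `|y - x| <= N%:R^-1 by rewrite distrC.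
have [c1 c2 c3] := node_point_close x0 y0 xy.
have [_ _ c4] := node_point_close y0 x0 yx.
case: kP => [kN|[kN kx ky]].
  have lastE z l : z <= 1 -> 0 <= z -> (k <= l <= k.+1)%N ->
      stage l z = node (cell z) \/ stage l z = z.
    move=> z1 z0; rewrite kN => /andP[]; rewrite leq_eqVlt => /predU1P[<- _|Nl _].
      by left; rewrite stage_high // cell_le1.
    by right; rewrite /stage leqNgt Nl.
  have [->|->] := lastE _ _ x1 x0 iP; have [->|->] := lastE _ _ y1 y0 jP => //.
  by rewrite distrC.
have lowE z l : (k <= cell z)%N -> (k <= l <= k.+1)%N ->
    exists2 m, stage l z = node m & (k <= m <= k.+1)%N.
  move=> kz /andP[kl lk]; exists (minn (cell z) l); first by rewrite /stage (leq_trans lk).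
  by rewrite leq_min kz kl geq_min lk orbT.
have [m -> /andP[km mk]] := lowE _ _ kx iP; have [l -> /andP[kl lk]] := lowE _ _ ky jP.
apply: le_trans (node_close _ _) _.
- by rewrite (leq_trans mk).
- by rewrite (leq_trans lk).
- by rewrite mulr_natl mulr2n lerDl invr_ge0 ltW.
Qed.

End Grid.

Section Line.
Variable R : realType.
Variable g : R -> R -> R.

Definition unit_itv (x : R) := 0 <= x <= 1.

Definition bisect (f : R -> R -> R) x y :=
  f x ((x + y) / 2) + f ((x + y) / 2) y.

Definition delta1 (f : R -> R -> R) x y z := f y z - f x z + f x y.

Lemma unit_mid x y : unit_itv x -> unit_itv y -> unit_itv ((x + y) / 2).
Proof. by rewrite /unit_itv => /andP[? ?] /andP[? ?]; apply/andP; split; lra. Qed.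

(** An error on intervals of length h is multiplied by the number 2 ^+ n of
    pieces, which balances the decay of [delta1 g] at scale 2 ^- n. *)
Lemma iter_bisect_bound n f e h x y :
  (forall a b, unit_itv a -> unit_itv b -> `|a - b| <= h -> `|f a b| <= e) ->
  unit_itv x -> unit_itv y -> `|x - y| <= 2 ^+ n * h ->
  `|iter n bisect f x y| <= 2 ^+ n * e.
Proof.
move=> fe; elim: n x y => [|n IH] x y ux uy; first by rewrite !expr0 !mul1r; apply: fe.
rewrite exprS -mulrA => xy /=; rewrite {1}/bisect (le_trans (ler_normD _ _)) //.
have um := unit_mid ux uy.
rewrite -mulrA [leRHS]mulr_natl mulr2n lerD // IH //.
  have -> : x - (x + y) / 2 = (x - y) / 2 by lra.
  by rewrite normrM (@ger0_norm _ 2^-1) // ler_pdivrMr // mulrC.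
have -> : (x + y) / 2 - y = (x - y) / 2 by lra.
by rewrite normrM (@ger0_norm _ 2^-1) // ler_pdivrMr // mulrC.
Qed.

Hypothesis g_diag : forall x, unit_itv x -> g x x = 0.
Hypothesis g_bisect : forall x y, unit_itv x -> unit_itv y -> g x y = bisect g x y.
Hypothesis g_small : forall e, 0 < e -> exists n0, forall n, (n0 <= n)%N ->
  forall x y z, unit_itv x -> unit_itv y -> unit_itv z ->
    {in [:: x; y; z] &, forall a b, `|a - b| <= 2 ^- n} ->
    `|delta1 g x y z| <= e / 2 ^+ n.

Lemma iter_bisect_sub_potential n (l : R -> R) x y :
  unit_itv x -> unit_itv y ->
  iter n bisect (fun a b => g a b - (l b - l a)) x y = g x y - (l y - l x).
Proof.
elim: n x y => //= n IH x y ux uy; rewrite /bisect !IH ?unit_mid //.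
by rewrite (g_bisect ux uy) /bisect; ring.
Qed.

Lemma unit_stage N k x : (0 < N)%N -> unit_itv x -> unit_itv (stage N k x).
Proof.
move=> N0 /andP[x0 x1]; rewrite /unit_itv stage_ge0 //=.
exact: le_trans (stage_le N0 _ x0) x1.
Qed.

(** The approximate primitive: g summed along the path of x from 0. *)
Definition climb (N : nat) (x : R) : R :=
  \sum_(k < N.+1) g (stage N k x) (stage N k.+1 x).

(** A quadrilateral with sides pq, qq', pp', p'q' is the difference of the two
    triangles that its diagonal pq' cuts off. *)
Lemma climb_step (p q p' q' e : R) :
  `|delta1 g p p' q'| <= e -> `|delta1 g p q q'| <= e ->
  `|(g p' q' - g p q) - (g q q' - g p p')| <= 2 * e.
Proof.
move=> h1 h2.
have -> : (g p' q' - g p q) - (g q q' - g p p') = delta1 g p p' q' - delta1 g p q q'.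
  by rewrite /delta1; ring.
by rewrite (le_trans (ler_normB _ _)) //; lra.
Qed.

(** Summing the quadrilaterals between the paths of x and y telescopes to the left
    hand side.  The quadrilateral of step k is degenerate when x and y move down
    together or stand still, which leaves the step at the smaller of the two cells
    and the initial rounding. *)
Lemma climb_potential n e x y :
  (forall x y z, unit_itv x -> unit_itv y -> unit_itv z ->
    {in [:: x; y; z] &, forall a b, `|a - b| <= 2 ^- n} ->
    `|delta1 g x y z| <= e) ->
  unit_itv x -> unit_itv y -> `|x - y| <= 2 ^- n.+1 ->
  `|g x y - (climb (2 ^ n.+1) y - climb (2 ^ n.+1) x)| <= 4 * e.
Proof.
set N := (2 ^ n.+1)%N => small ux uy xy.
have N0 : (0 < N)%N by rewrite expn_gt0.
have Nh : N%:R^-1 = 2 ^- n.+1 :> R by rewrite /N natrX.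
have h2 : 2 ^- n = 2 * 2 ^- n.+1 :> R by rewrite exprS invfM mulrA divff // mul1r.
have h0 : 0 <= 2 ^- n.+1 :> R by rewrite invr_ge0 exprn_ge0.
have e0 : 0 <= e.
  by apply: le_trans (small x x x ux ux ux _); rewrite // => a b;
     rewrite !inE => /or3P[]/eqP-> /or3P[]/eqP->; rewrite subrr normr0 invr_ge0 exprn_ge0.
have [[x0 x1] [y0 y1]] := (andP ux, andP uy).
pose F k := g (stage N k x) (stage N k y).
pose T k := (F k.+1 - F k) - (g (stage N k y) (stage N k.+1 y) -
                               g (stage N k x) (stage N k.+1 x)).
have -> : g x y - (climb N y - climb N x) = \sum_(k < N.+1) T k.
  rewrite /T sumrB [X in _ = _ - X]sumrB; congr (_ - _).
  rewrite -(big_mkord xpredT (fun k => F k.+1 - F k)) telescope_sumr //.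
  by rewrite /F !stage_last !stage0 [g 0 0]g_diag ?subr0 // /unit_itv lexx ler01.
have cxy : (cell N x <= (cell N y).+1)%N by apply: cell_close => //; rewrite Nh.
have cyx : (cell N y <= (cell N x).+1)%N by apply: cell_close; rewrite // Nh distrC.
have bound k : k = N \/ [/\ (k < N)%N, (k <= cell N x)%N & (k <= cell N y)%N] ->
    `|T k| <= 2 * e.
  move=> kP.
  have kk : (k <= k <= k.+1)%N by rewrite leqnn leqnSn.
  have kk' : (k <= k.+1 <= k.+1)%N by rewrite leqnn leqnSn.
  have kP' : k = N \/ [/\ (k < N)%N, (k <= cell N y)%N & (k <= cell N x)%N].
    by case: kP => [|[]]; [left|right].
  have kPx : k = N \/ [/\ (k < N)%N, (k <= cell N x)%N & (k <= cell N x)%N].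
    by case: kP => [|[]]; [left|right].
  have kPy : k = N \/ [/\ (k < N)%N, (k <= cell N y)%N & (k <= cell N y)%N].
    by case: kP => [|[]]; [left|right].
  have diag (z : R) : `|z - z| <= N%:R^-1 by rewrite subrr normr0 Nh.
  have yx : `|y - x| <= N%:R^-1 by rewrite distrC Nh.
  apply: climb_step; apply: small; rewrite ?unit_stage // => a b; rewrite !inE h2 -Nh.
    by do 2![case/or3P=> /eqP ->]; apply: (@stage_close _ _ _ _ _ k) => //; rewrite ?Nh //.
  by do 2![case/or3P=> /eqP ->]; apply: (@stage_close _ _ _ _ _ k) => //; rewrite ?Nh //.
rewrite big_ord_recr /= (le_trans (ler_normD _ _)) //.
have -> : 4 * e = 2 * e + 2 * e by lra.
apply: lerD; last by apply: bound; left.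
apply: (@norm_sum_single _ T (minn (cell N x) (cell N y))).
- by rewrite mulr_ge0.
- move=> k kN kc; rewrite /T /F.
  have [|ck] := ltnP k (minn (cell N x) (cell N y)).
    rewrite leq_min => /andP[kx ky].
    rewrite !(stage_low kN) // !(stage_low (ltnW kN)) ?(ltnW kx) ?(ltnW ky) //.
    have u i : (i <= N)%N -> unit_itv (node R N i).
      move=> iN; rewrite /unit_itv node_ge0 /= ler_pdivrMr ?ltr0n //.
      by rewrite mul1r ler_nat.
    by rewrite !g_diag ?u ?(ltnW kN) //; ring.
  have [cx cy] : (cell N x <= k)%N /\ (cell N y <= k)%N by apply: above_min.
  have ui z : unit_itv z -> unit_itv (node R N (cell N z)).
    move=> /andP[z0 z1]; rewrite /unit_itv node_ge0 /=.
    by rewrite (le_trans (node_cell_le N0 z0)).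
  rewrite !(stage_high (ltnW kN)) // !stage_high ?leqW //.
  by rewrite !g_diag ?ui //; ring.
- by move=> jN; apply: bound; right; rewrite geq_minl geq_minr.
Qed.

(** The increments of any function form a germ that is invariant under bisection,
    so n bisections turn the local estimate of [climb_potential] into a global one
    with a factor 2 ^+ n, which the smallness of [delta1 g] absorbs. *)
Lemma line_closed x y z : unit_itv x -> unit_itv y -> unit_itv z ->
  delta1 g x y z = 0.
Proof.
(* Three faces, each with the error 8 * e = 2 ^+ n0.+1 * (4 * (e / 2 ^+ n0)). *)
move=> ux uy uz; apply: (@eq0_small_norm _ _ 24) => // e /g_small[n0 /(_ n0 (leqnn _)) sm].
pose l := climb (2 ^ n0.+1).
have near a b : unit_itv a -> unit_itv b -> `|g a b - (l b - l a)| <= 8 * e.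
  move=> ua ub; rewrite -(iter_bisect_sub_potential n0.+1) //.
  have -> : 8 * e = 2 ^+ n0.+1 * (4 * (e / 2 ^+ n0)).
    rewrite exprS; have : 2 ^+ n0 != 0 :> R by rewrite expf_neq0.
    by move: (2 ^+ n0) => w w0; field.
  apply: (@iter_bisect_bound _ _ _ (2 ^- n0.+1)) => //.
    by move=> *; apply: climb_potential.
  rewrite divff ?expf_neq0 //; move: ua ub; rewrite /unit_itv ler_norml.
  by move=> /andP[? ?] /andP[? ?]; apply/andP; split; lra.
have -> : delta1 g x y z = (g y z - (l z - l y)) - (g x z - (l z - l x))
   + (g x y - (l y - l x)) by rewrite /delta1; ring.
have := near _ _ uy uz; have := near _ _ ux uz; have := near _ _ ux uy.
move: (g y z - _) (g x z - _) (g x y - _) => A B C.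
rewrite !ler_norml => /andP[? ?] /andP[? ?] /andP[? ?].
by apply/andP; split; lra.
Qed.

End Line.

(** * Germs on triangles of a planar simplex *)

Section Triangle.
Variable R : realType.
Local Notation P := (R * R)%type.
Implicit Types (p q r s : P) (f : P -> P -> P -> R).

Definition in_tri (p : P) := [/\ 0 <= p.2, p.2 <= p.1 & p.1 <= 1].

Definition close (h : R) (p q : P) := `|p.1 - q.1| <= h /\ `|p.2 - q.2| <= h.

Definition midp (p q : P) : P := ((p.1 + q.1) / 2, (p.2 + q.2) / 2).

Definition bisect2 (l : P -> P -> R) p q := l p (midp p q) + l (midp p q) q.

(** The vertices of the middle triangle are listed so that it is the image of p q r
    under a homothety of ratio -1/2; then [quarter] commutes with permutations of
    the three arguments. *)
Definition quarter f p q r :=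
  f p (midp p q) (midp p r) + f (midp p q) q (midp q r) +
  f (midp p r) (midp q r) r + f (midp q r) (midp p r) (midp p q).

Definition coboundary (l : P -> P -> R) p q r := l q r - l p r + l p q.

Definition delta2 f p q r s := f q r s - f p r s + f p q s - f p q r.

Lemma midpC p q : midp p q = midp q p.
Proof. by rewrite /midp ![p.1 + _]addrC ![p.2 + _]addrC. Qed.

Lemma in_tri_mid p q : in_tri p -> in_tri q -> in_tri (midp p q).
Proof. by case=> [? ? ?] [? ? ?]; split; rewrite /midp /=; lra. Qed.

(** The boundaries of the four small triangles add up to the bisected boundary of
    the large one, the interior edges being traversed in both directions. *)
Lemma quarter_coboundary l p q r : (forall a b, l b a = - l a b) ->
  quarter (coboundary l) p q r = coboundary (bisect2 l) p q r.
Proof.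
move=> lC; rewrite /quarter /coboundary /bisect2.
rewrite [l (midp p r) (midp p q)]lC [l (midp q r) (midp p q)]lC.
by rewrite [l (midp p r) (midp q r)]lC; ring.
Qed.

Lemma iter_quarter_coboundary n l p q r : (forall a b, l b a = - l a b) ->
  iter n quarter (coboundary l) p q r = coboundary (iter n bisect2 l) p q r.
Proof.
move=> lC; have lnC m a b : iter m bisect2 l b a = - iter m bisect2 l a b.
  elim: m a b => //= m IH a b; rewrite /bisect2 midpC IH.
  by rewrite [iter _ _ _ _ a]IH; ring.
elim: n p q r => //= n IH p q r; rewrite -quarter_coboundary // /quarter.
by rewrite !IH.
Qed.

Lemma iter_quarterB n f f' p q r :
  iter n quarter (fun a b c => f a b c - f' a b c) p q r =
  iter n quarter f p q r - iter n quarter f' p q r.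
Proof. by elim: n p q r => //= n IH p q r; rewrite /quarter !IH; ring. Qed.

Lemma iter_quarter_id n f p q r :
  (forall a b c, in_tri a -> in_tri b -> in_tri c -> quarter f a b c = f a b c) ->
  in_tri p -> in_tri q -> in_tri r -> iter n quarter f p q r = f p q r.
Proof.
move=> fq; elim: n p q r => //= n IH p q r tp tq tr.
by rewrite -[RHS]fq // /quarter !IH //; apply: in_tri_mid.
Qed.

Lemma close_sym h p q : close h p q -> close h q p.
Proof. by case=> ? ?; split; rewrite distrC. Qed.

Lemma close_half h (a b c d : P) :
  close (2 * h) a b -> c.1 - d.1 = (a.1 - b.1) / 2 -> c.2 - d.2 = (a.2 - b.2) / 2 ->
  close h c d.
Proof.
move=> [h1 h2] e1 e2; split; rewrite ?e1 ?e2 normrM (@ger0_norm _ 2^-1) //.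
  by rewrite ler_pdivrMr // mulrC.
by rewrite ler_pdivrMr // mulrC.
Qed.

Lemma iter_quarter_bound n f e h p q r :
  (forall a b c, in_tri a -> in_tri b -> in_tri c ->
    close h a b -> close h b c -> close h a c -> `|f a b c| <= e) ->
  in_tri p -> in_tri q -> in_tri r ->
  close (2 ^+ n * h) p q -> close (2 ^+ n * h) q r -> close (2 ^+ n * h) p r ->
  `|iter n quarter f p q r| <= 4 ^+ n * e.
Proof.
move=> fe; elim: n p q r => [|n IH] p q r tp tq tr.
  by rewrite !expr0 !mul1r; apply: fe.
rewrite !exprS -!mulrA => pq qr pr /=.
have [tpq tqr tpr] : [/\ in_tri (midp p q), in_tri (midp q r) & in_tri (midp p r)].
  by split; apply: in_tri_mid.
have half a b : close (2 * (2 ^+ n * h)) a b -> forall c d, c.1 - d.1 = (a.1 - b.1) / 2 ->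
    c.2 - d.2 = (a.2 - b.2) / 2 -> close (2 ^+ n * h) c d.
  by move=> ab c d; apply: close_half.
rewrite {1}/quarter; set E := 4 ^+ n * e.
have -> : 4 * E = E + E + E + E by lra.
have [rq qp rp] := And3 (close_sym qr) (close_sym pq) (close_sym pr).
apply: le_trans (ler_normD _ _) _; apply: lerD.
apply: le_trans (ler_normD _ _) _; apply: lerD.
apply: le_trans (ler_normD _ _) _; apply: lerD.
all: apply: IH => //.
- by apply: half pq _ _ _ _; rewrite /midp /=; lra.
- by apply: half qr _ _ _ _; rewrite /midp /=; lra.
- by apply: half pr _ _ _ _; rewrite /midp /=; lra.
- by apply: half pq _ _ _ _; rewrite /midp /=; lra.
- by apply: half qr _ _ _ _; rewrite /midp /=; lra.
- by apply: half pr _ _ _ _; rewrite /midp /=; lra.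
- by apply: half pq _ _ _ _; rewrite /midp /=; lra.
- by apply: half qr _ _ _ _; rewrite /midp /=; lra.
- by apply: half pr _ _ _ _; rewrite /midp /=; lra.
- by apply: half qp _ _ _ _; rewrite /midp /=; lra.
- by apply: half rq _ _ _ _; rewrite /midp /=; lra.
- by apply: half rp _ _ _ _; rewrite /midp /=; lra.
Qed.

Variable g : P -> P -> P -> R.
Hypothesis g_left : forall p q, in_tri p -> in_tri q -> g p p q = 0.
Hypothesis g_right : forall p q, in_tri p -> in_tri q -> g p q q = 0.
Hypothesis g_ends : forall p q, in_tri p -> in_tri q -> g p q p = 0.
Hypothesis g_axis : forall p q r, in_tri p -> in_tri q -> in_tri r ->
  p.2 = 0 -> q.2 = 0 -> r.2 = 0 -> g p q r = 0.
Hypothesis g_quarter : forall p q r, in_tri p -> in_tri q -> in_tri r ->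
  quarter g p q r = g p q r.
Hypothesis g_small : forall e, 0 < e -> exists n0, forall n, (n0 <= n)%N ->
  forall p q r s, in_tri p -> in_tri q -> in_tri r -> in_tri s ->
    {in [:: p; q; r; s] &, forall a b, close (2 ^- n) a b} ->
    `|delta2 g p q r s| <= e / 4 ^+ n.

Lemma tri_close n p q : in_tri p -> in_tri q -> close (2 ^+ n * 2 ^- n) p q.
Proof.
rewrite divff ?expf_neq0 // => -[? ? ?] [? ? ?].
by split; rewrite ler_norml; apply/andP; split; lra.
Qed.

(** An invariant germ is the sum of 4 ^+ n values at scale 2 ^- n. *)
Lemma quarter_small0 f :
  (forall p q r, in_tri p -> in_tri q -> in_tri r -> quarter f p q r = f p q r) ->
  (forall e, 0 < e -> exists n, forall p q r, in_tri p -> in_tri q -> in_tri r ->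
    close (2 ^- n) p q -> close (2 ^- n) q r -> close (2 ^- n) p r ->
    `|f p q r| <= e / 4 ^+ n) ->
  forall p q r, in_tri p -> in_tri q -> in_tri r -> f p q r = 0.
Proof.
move=> fq fs p q r tp tq tr; apply: (@eq0_small_norm _ _ 1) => // e /fs[n sm].
rewrite -(iter_quarter_id n fq) // mul1r.
have -> : e = 4 ^+ n * (e / 4 ^+ n) by rewrite mulrC divfK // expf_neq0.
by apply: (iter_quarter_bound (h := 2 ^- n)) => //; apply: tri_close.
Qed.

Lemma close_refl h p : 0 <= h -> close h p p.
Proof. by move=> h0; split; rewrite subrr normr0. Qed.

Lemma close_in_sub (h : R) (s t : seq P) :
  {in s &, forall a b, close h a b} -> {subset t <= s} ->
  {in t &, forall a b, close h a b}.
Proof. by move=> H ts a b /ts sa /ts sb; apply: H. Qed.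

Lemma close_in3 (h : R) p q r : 0 <= h -> close h p q -> close h q r -> close h p r ->
  {in [:: p; q; r] &, forall a b, close h a b}.
Proof.
move=> h0 pq qr pr a b; rewrite !inE.
by do 2![case/or3P=> /eqP->] => //; solve [exact: close_refl | exact: close_sym].
Qed.

(** As g vanishes on triangles with a repeated vertex, g p q r + g q p r equals
    [delta2 g p q p r], which is small at small scales. *)
Lemma antisym12 p q r : in_tri p -> in_tri q -> in_tri r -> g q p r = - g p q r.
Proof.
move=> tp tq tr; apply/eqP; rewrite -addr_eq0; apply/eqP.
apply: (@quarter_small0 (fun p q r => g q p r + g p q r)) => //.
  move=> {}p {}q {}r {}tp {}tq {}tr; rewrite -(g_quarter tp) // -(g_quarter tq) //.
  by rewrite /quarter ![midp q p]midpC; ring.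
move=> e /g_small[n /(_ n (leqnn _)) sm]; exists n => {}p {}q {}r {}tp {}tq {}tr pq qr pr.
have -> : g q p r + g p q r = delta2 g p q p r.
  by rewrite /delta2 g_left // g_ends //; ring.
apply: sm => //; apply: close_in_sub (close_in3 _ pq qr pr) _.
  by rewrite invr_ge0 exprn_ge0.
by move=> a; rewrite !inE => /or4P[]->; rewrite ?orbT.
Qed.

Lemma antisym23 p q r : in_tri p -> in_tri q -> in_tri r -> g p r q = - g p q r.
Proof.
move=> tp tq tr; apply/eqP; rewrite -addr_eq0; apply/eqP.
apply: (@quarter_small0 (fun p q r => g p r q + g p q r)) => //.
  move=> {}p {}q {}r {}tp {}tq {}tr; rewrite -(g_quarter tp tr tq) -(g_quarter tp tq tr).
  by rewrite /quarter ![midp r q]midpC; ring.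
move=> e /g_small[n /(_ n (leqnn _)) sm]; exists n => {}p {}q {}r {}tp {}tq {}tr pq qr pr.
have -> : g p r q + g p q r = - delta2 g p q r q.
  by rewrite /delta2 g_ends // g_right //; ring.
rewrite normrN; apply: sm => //; apply: close_in_sub (close_in3 _ pq qr pr) _.
  by rewrite invr_ge0 exprn_ge0.
by move=> a; rewrite !inE => /or4P[]->; rewrite ?orbT.
Qed.

Lemma antisym13 p q r : in_tri p -> in_tri q -> in_tri r -> g r q p = - g p q r.
Proof.
by move=> tp tq tr; rewrite antisym12 // antisym23 // antisym12 // !opprK.
Qed.

(** The value of g on the quadrilateral between pq and p'q', triangulated by the
    diagonal pq'.  [wall] averages the two triangulations: it is antisymmetric,
    which makes a prism with two equal sides vanish exactly. *)
Definition half_wall p q p' q' := g p q q' - g p p' q'.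

Definition wall p q p' q' := (half_wall p q p' q' - half_wall q p q' p') / 2.

(** The sum of g over the surface of the prism from pqr to p'q'r'. *)
Definition prism p q r p' q' r' :=
  g p' q' r' - g p q r +
  (wall q r q' r' - wall p r p' r' + wall p q p' q').

Lemma wallC p q p' q' : wall q p q' p' = - wall p q p' q'.
Proof. by rewrite /wall; field. Qed.

Lemma wall_diag p p' : wall p p p' p' = 0.
Proof. by rewrite /wall subrr mul0r. Qed.

Definition half_prism p q r p' q' r' :=
  delta2 g p q r r' - delta2 g p q q' r' + delta2 g p p' q' r'.

(** A prism is a union of three tetrahedra; the two terms are the two ways to
    cut it that [wall] averages. *)
Lemma prismE p q r p' q' r' : in_tri p -> in_tri q -> in_tri r ->
  in_tri p' -> in_tri q' -> in_tri r' ->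
  prism p q r p' q' r' = (half_prism p q r p' q' r' - half_prism r q p r' q' p') / 2.
Proof.
move=> tp tq tr tp' tq' tr'.
have e1 := antisym13 tp tq tr; have e2 := antisym13 tp' tq' tr'.
rewrite /prism /wall /half_wall /half_prism /delta2.
by rewrite e1 e2; field.
Qed.

Lemma prism_eq12 p r p' r' : in_tri p -> in_tri r -> in_tri p' -> in_tri r' ->
  prism p p r p' p' r' = 0.
Proof. by move=> *; rewrite /prism !g_left // wall_diag; ring. Qed.

Lemma prism_eq23 p r p' r' : in_tri p -> in_tri r -> in_tri p' -> in_tri r' ->
  prism p r r p' r' r' = 0.
Proof. by move=> *; rewrite /prism !g_right // wall_diag; ring. Qed.

Lemma prism_eq13 p q p' q' : in_tri p -> in_tri q -> in_tri p' -> in_tri q' ->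
  prism p q p p' q' p' = 0.
Proof. by move=> *; rewrite /prism !g_ends // wall_diag (wallC p q); ring. Qed.

Lemma prism_const p q r : in_tri p -> in_tri q -> in_tri r ->
  prism p q r p q r = 0.
Proof.
move=> *; rewrite /prism /wall /half_wall.
by rewrite !(g_left, g_right, g_ends) //; field.
Qed.

Lemma prism_bound p q r p' q' r' e h : in_tri p -> in_tri q -> in_tri r ->
  in_tri p' -> in_tri q' -> in_tri r' ->
  (forall a b c d, in_tri a -> in_tri b -> in_tri c -> in_tri d ->
    {in [:: a; b; c; d] &, forall a b, close h a b} ->
    `|delta2 g a b c d| <= e) ->
  {in [:: p; q; r; p'; q'; r'] &, forall a b, close h a b} ->
  `|prism p q r p' q' r'| <= 3 * e.
Proof.
move=> tp tq tr tp' tq' tr' small cl; rewrite prismE //.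
have B a b c d : in_tri a -> in_tri b -> in_tri c -> in_tri d ->
    {subset [:: a; b; c; d] <= [:: p; q; r; p'; q'; r']} -> `|delta2 g a b c d| <= e.
  by move=> *; apply: small => //; apply: close_in_sub cl _.
have sub a b c d : all (mem [:: p; q; r; p'; q'; r']) [:: a; b; c; d] ->
   {subset [:: a; b; c; d] <= [:: p; q; r; p'; q'; r']} by move/allP.
have H1 : `|delta2 g p q r r'| <= e by apply: B => //; apply: sub; rewrite /= !inE !eqxx ?orbT.
have H2 : `|delta2 g p q q' r'| <= e by apply: B => //; apply: sub; rewrite /= !inE !eqxx ?orbT.
have H3 : `|delta2 g p p' q' r'| <= e by apply: B => //; apply: sub; rewrite /= !inE !eqxx ?orbT.
have H4 : `|delta2 g r q p p'| <= e by apply: B => //; apply: sub; rewrite /= !inE !eqxx ?orbT.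
have H5 : `|delta2 g r q q' p'| <= e by apply: B => //; apply: sub; rewrite /= !inE !eqxx ?orbT.
have H6 : `|delta2 g r r' q' p'| <= e by apply: B => //; apply: sub; rewrite /= !inE !eqxx ?orbT.
clear -H1 H2 H3 H4 H5 H6; rewrite /half_prism.
move: (delta2 g p q r r') (delta2 g p q q' r') (delta2 g p p' q' r') H1 H2 H3 => a b c.
move: (delta2 g r q p p') (delta2 g r q q' p') (delta2 g r r' q' p') H4 H5 H6 => a' b' c'.
rewrite !ler_norml => /andP[? ?] /andP[? ?] /andP[? ?] /andP[? ?] /andP[? ?] /andP[? ?].
by apply/andP; split; lra.
Qed.

(** The abscissa is only rounded; after that the point goes down its column.  The
    triangle is stable, since y <= x is preserved by rounding down. *)
Definition stage2 (N k : nat) p : P := (stage N (maxn k N) p.1, stage N k p.2).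

Lemma in_tri_stage2 N k p : (0 < N)%N -> in_tri p -> in_tri (stage2 N k p).
Proof.
move=> N0 [p0 p1 p2]; have q0 := le_trans p0 p1; rewrite /in_tri /=.
split; rewrite ?stage_ge0 //; last exact: le_trans (stage_le N0 _ q0) p2.
have [kN|Nk] := leqP k N.
  rewrite [stage N N _]stage_high ?cell_le1 // /stage kN node_le // geq_min.
  by rewrite cell_le.
by rewrite /stage leqNgt Nk.
Qed.

(** The sum of the walls that the segment from p to q sweeps on its way to the
    bottom side; the sign makes g its approximate coboundary. *)
Definition potential N p q : R :=
  - \sum_(k < N.+1) wall (stage2 N k p) (stage2 N k q) (stage2 N k.+1 p) (stage2 N k.+1 q).

Lemma potentialC N p q : potential N q p = - potential N p q.
Proof. by rewrite /potential opprK -sumrN; apply: eq_bigr => k _; rewrite wallC opprK. Qed.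

Lemma stage2_close N p q k i j : (0 < N)%N -> in_tri p -> in_tri q -> close N%:R^-1 p q ->
  k = N \/ [/\ (k < N)%N, (k <= cell N p.2)%N & (k <= cell N q.2)%N] ->
  (k <= i <= k.+1)%N -> (k <= j <= k.+1)%N ->
  close (2 * N%:R^-1) (stage2 N i p) (stage2 N j q).
Proof.
move=> N0 [p0 p1 p2] [q0 q1 q2] [pq1 pq2] kP iP jP.
have kN : (k <= N)%N by case: kP => [->|[/ltnW]].
have [u1 u2 v1 v2] : [/\ 0 <= p.1 <= 1, 0 <= p.2 <= 1, 0 <= q.1 <= 1 & 0 <= q.2 <= 1].
  by split; lra.
split; last exact: (@stage_close _ _ N0 _ _ k).
have mx l : (k <= l <= k.+1)%N -> (N <= maxn l N <= N.+1)%N.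
  move=> /andP[_ lk]; rewrite leq_maxr geq_max leqnSn andbT (leq_trans lk) //.
by apply: (@stage_close _ _ N0 _ _ N) => //; [left | exact: mx | exact: mx].
Qed.

(** The left hand side telescopes to the sum of the prisms swept by p q r.  While
    all three points go down, two of them share their column, so that the prism
    has two equal sides; once the lowest one has been passed by one step, all stand
    still.  What remains is the step at the lowest cell and the initial
    rounding. *)
Lemma potential_close n e p q r :
  (forall a b c d, in_tri a -> in_tri b -> in_tri c -> in_tri d ->
    {in [:: a; b; c; d] &, forall a b, close (2 ^- n) a b} ->
    `|delta2 g a b c d| <= e) ->
  in_tri p -> in_tri q -> in_tri r ->
  close (2 ^- n.+1) p q -> close (2 ^- n.+1) q r -> close (2 ^- n.+1) p r ->
  `|g p q r - coboundary (potential (2 ^ n.+1)) p q r| <= 6 * e.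
Proof.
set N := (2 ^ n.+1)%N => small tp tq tr pq qr pr.
have N0 : (0 < N)%N by rewrite expn_gt0.
have Nh : N%:R^-1 = 2 ^- n.+1 :> R by rewrite /N natrX.
have h2 : 2 ^- n = 2 * 2 ^- n.+1 :> R by rewrite exprS invfM mulrA divff // mul1r.
have h0 : 0 <= 2 ^- n.+1 :> R by rewrite invr_ge0 exprn_ge0.
have e0 : 0 <= e.
  apply: le_trans (small p p p p tp tp tp tp _); rewrite // h2 => a b.
  by rewrite !inE => /or4P[]/eqP-> /or4P[]/eqP->; apply: close_refl; rewrite mulr_ge0.
have cl : {in [:: p; q; r] &, forall a b, close N%:R^-1 a b}.
  by rewrite Nh; apply: close_in3.
have ts a k : in_tri a -> in_tri (stage2 N k a) by move=> ?; apply: in_tri_stage2.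
pose F k := g (stage2 N k p) (stage2 N k q) (stage2 N k r).
pose T k := prism (stage2 N k p) (stage2 N k q) (stage2 N k r)
                  (stage2 N k.+1 p) (stage2 N k.+1 q) (stage2 N k.+1 r).
have -> : g p q r - coboundary (potential N) p q r = \sum_(k < N.+1) T k.
  transitivity (\sum_(k < N.+1) (F k.+1 - F k) +
      coboundary (fun a b => \sum_(k < N.+1) wall (stage2 N k a) (stage2 N k b)
         (stage2 N k.+1 a) (stage2 N k.+1 b)) p q r); last first.
    by rewrite /coboundary -sumrB -!big_split.
  rewrite -(big_mkord xpredT (fun k => F k.+1 - F k)) telescope_sumr //.
  have -> : F 0 = 0 by apply: g_axis; rewrite /= ?stage0 //; apply: ts.
  rewrite subr0 /coboundary /potential.
  have last a : stage2 N N.+1 a = a.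
    by rewrite /stage2 (maxn_idPl (leqnSn N)) !stage_last; case: a.
  by rewrite /F !last; ring.
have bound k : k = N \/
    [/\ (k < N)%N, (k <= cell N p.2)%N, (k <= cell N q.2)%N & (k <= cell N r.2)%N] ->
    `|T k| <= 3 * e.
  move=> kP.
  have kk : (k <= k <= k.+1)%N by rewrite leqnn leqnSn.
  have kk' : (k <= k.+1 <= k.+1)%N by rewrite leqnn leqnSn.
  have scl : {in [:: p; q; r] &, forall a b, forall i j, (k <= i <= k.+1)%N ->
      (k <= j <= k.+1)%N -> close (2 ^- n) (stage2 N i a) (stage2 N j b)}.
    move=> a b ha hb i j iP jP; rewrite h2 -Nh.
    have tin c : c \in [:: p; q; r] -> in_tri c by rewrite !inE => /or3P[]/eqP->.
    apply: (@stage2_close _ _ _ k) => //; try exact: tin; first exact: cl.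
    case: kP => [->|[kN kp kq kr]]; [by left | right; split => //].
      by move: ha; rewrite !inE => /or3P[]/eqP->.
    by move: hb; rewrite !inE => /or3P[]/eqP->.
  apply: (prism_bound (h := 2 ^- n)) => //; try exact: ts.
  move=> a b.
  have inP c : c \in [:: stage2 N k p; stage2 N k q; stage2 N k r; stage2 N k.+1 p;
        stage2 N k.+1 q; stage2 N k.+1 r] ->
      exists2 d, d \in [:: p; q; r] & exists2 i, (k <= i <= k.+1)%N & c = stage2 N i d.
    rewrite inE => /orP[/eqP->|]; first by exists p; rewrite ?inE ?eqxx //; exists k.
    rewrite inE => /orP[/eqP->|]; first by exists q; rewrite ?inE ?eqxx ?orbT //; exists k.
    rewrite inE => /orP[/eqP->|]; first by exists r; rewrite ?inE ?eqxx ?orbT //; exists k.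
    rewrite inE => /orP[/eqP->|]; first by exists p; rewrite ?inE ?eqxx //; exists k.+1.
    rewrite inE => /orP[/eqP->|]; first by exists q; rewrite ?inE ?eqxx ?orbT //; exists k.+1.
    by rewrite inE => /eqP->; exists r; rewrite ?inE ?eqxx ?orbT //; exists k.+1.
  by move=> /inP[a' a'in [i iP ->]] /inP[b' b'in [j jP ->]]; apply: scl.
rewrite big_ord_recr /= (le_trans (ler_normD _ _)) //.
have -> : 6 * e = 3 * e + 3 * e by lra.
apply: lerD; last by apply: bound; left.
pose j0 := minn (minn (cell N p.2) (cell N q.2)) (cell N r.2).
apply: (@norm_sum_single _ T j0).
- by rewrite mulr_ge0.
- move=> k kN kj.
  have adj (c : P -> R) : {in [:: p; q; r], forall a, 0 <= c a} ->
      {in [:: p; q; r] &, forall a b, `|c a - c b| <= N%:R^-1} ->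
      {in [:: p; q; r] &, forall a b, (cell N (c a) <= (cell N (c b)).+1)%N}.
    by move=> c0 cc a b ha hb; apply: cell_close; rewrite // ?c0 ?cc.
  have [xadj yadj] : {in [:: p; q; r] &, forall a b, (cell N a.1 <= (cell N b.1).+1)%N} /\
     {in [:: p; q; r] &, forall a b, (cell N a.2 <= (cell N b.2).+1)%N}.
    split; apply: adj => [a|a b ha hb]; try by have [] := cl _ _ ha hb.
      by rewrite !inE => /or3P[]/eqP->; [case: tp|case: tq|case: tr] => ? ? ?; lra.
    by rewrite !inE => /or3P[]/eqP->; [case: tp|case: tq|case: tr].
  have [pin qin rin] : [/\ p \in [:: p; q; r], q \in [:: p; q; r] & r \in [:: p; q; r]].
    by rewrite !inE !eqxx ?orbT.
  have [kj0|j0k] := ltnP k j0.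
    have low a : a \in [:: p; q; r] -> (k < cell N a.2)%N.
      by move: kj0; rewrite /j0 !leq_min => /andP[/andP[? ?] ?];
         rewrite !inE => /or3P[]/eqP->.
    have eq_col a b : in_tri a -> in_tri b -> (k < cell N a.2)%N -> (k < cell N b.2)%N ->
        cell N a.1 = cell N b.1 ->
        stage2 N k a = stage2 N k b /\ stage2 N k.+1 a = stage2 N k.+1 b.
      move=> [a0 a1 a2] [b0 b1 b2] ka kb eab.
      have [a0' b0'] := (le_trans a0 a1, le_trans b0 b1).
      rewrite /stage2 (maxn_idPr kN) (maxn_idPr (ltnW kN)).
      rewrite ![stage N N _]stage_high ?cell_le1 // eab.
      by rewrite !(stage_low kN) // !(stage_low (ltnW kN)) // ltnW.
    have [|[|]] : cell N p.1 = cell N q.1 \/ cell N q.1 = cell N r.1 \/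
        cell N p.1 = cell N r.1.
    + have := xadj p q pin qin; have := xadj q p qin pin.
      have := xadj p r pin rin; have := xadj r p rin pin.
      have := xadj q r qin rin; have := xadj r q rin qin.
      by move: (cell N p.1) (cell N q.1) (cell N r.1) => a b c; clear; lia.
    + move=> /(eq_col p q tp tq (low _ pin) (low _ qin)) [e1 e2].
      by rewrite /T e1 e2 prism_eq12 //; apply: ts.
    + move=> /(eq_col q r tq tr (low _ qin) (low _ rin)) [e1 e2].
      by rewrite /T e1 e2 prism_eq23 //; apply: ts.
    + move=> /(eq_col p r tp tr (low _ pin) (low _ rin)) [e1 e2].
      by rewrite /T e1 e2 prism_eq13 //; apply: ts.
  have [cp cq cr] : [/\ (cell N p.2 <= k)%N, (cell N q.2 <= k)%N & (cell N r.2 <= k)%N].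
    have := yadj p q pin qin; have := yadj q p qin pin.
    have := yadj p r pin rin; have := yadj r p rin pin.
    have := yadj q r qin rin; have := yadj r q rin qin.
    move: kj j0k; rewrite /j0; move: (cell N p.2) (cell N q.2) (cell N r.2) => a b c.
    by clear; split; lia.
  have stay a : (cell N a.2 <= k)%N -> stage2 N k.+1 a = stage2 N k a.
    move=> ak; rewrite /stage2 (maxn_idPr kN) (maxn_idPr (ltnW kN)).
    by rewrite (stage_high (ltnW kN)) // (stage_high kN) // leqW.
  by rewrite /T !stay // prism_const //; apply: ts.
- move=> jN; apply: bound; right; split => //; rewrite /j0.
  + by rewrite -minnA geq_minl.
  + by rewrite (minnC (cell N p.2)) -minnA geq_minl.
  + by rewrite geq_minr.
Qed.

(** Quartering n.+1 times fixes g and maps coboundaries to coboundaries, while the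
    local error of [potential_close] is multiplied by 4 ^+ n.+1.  The coboundary of
    a coboundary is 0, so delta g is within a multiple of e of 0 for every e. *)
Lemma triangle_closed p q r s : in_tri p -> in_tri q -> in_tri r -> in_tri s ->
  delta2 g p q r s = 0.
Proof.
(* Four faces, each with the error 24 * e = 4 ^+ n.+1 * (6 * (e / 4 ^+ n)). *)
move=> tp tq tr ts; apply: (@eq0_small_norm _ _ 96) => // e /g_small[n /(_ n (leqnn _)) sm].
pose l := iter n.+1 bisect2 (potential (2 ^ n.+1)).
have near a b c : in_tri a -> in_tri b -> in_tri c ->
    `|g a b c - coboundary l a b c| <= 24 * e.
  move=> ta tb tc; rewrite -iter_quarter_coboundary; last by move=> ? ?; apply: potentialC.
  rewrite -(iter_quarter_id n.+1 g_quarter ta) // -iter_quarterB.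
  have -> : 24 * e = 4 ^+ n.+1 * (6 * (e / 4 ^+ n)).
    rewrite exprS; have : 4 ^+ n != 0 :> R by rewrite expf_neq0.
    by move: (4 ^+ n) => w w0; field.
  apply: (iter_quarter_bound (h := 2 ^- n.+1)) => //; try exact: tri_close.
  by move=> *; apply: potential_close.
have -> : delta2 g p q r s = (g q r s - coboundary l q r s) -
    (g p r s - coboundary l p r s) + (g p q s - coboundary l p q s) -
    (g p q r - coboundary l p q r) by rewrite /delta2 /coboundary; ring.
have := near _ _ _ tp tq tr; have := near _ _ _ tp tq ts.
have := near _ _ _ tp tr ts; have := near _ _ _ tq tr ts.
move: (g q r s - _) (g p r s - _) (g p q s - _) (g p q r - _) => A B C E.
rewrite !ler_norml => /andP[? ?] /andP[? ?] /andP[? ?] /andP[? ?].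
by apply/andP; split; lra.
Qed.

End Triangle.

(** * Barycentric maps, midpoints and isometries *)

Section Stochastic.
Variable R : realType.

Definition stochastic (m n : nat) (M : 'M[R]_(m, n)) : Prop :=
  (forall i j, 0 <= M i j) /\ (forall i, \sum_j M i j = 1).

Lemma stochastic1 n : stochastic (1%:M : 'M[R]_n).
Proof.
split=> [i j|i]; first by rewrite mxE.
rewrite (bigD1 i) //= big1 ?addr0; first by rewrite mxE eqxx.
by move=> j ji; rewrite mxE eq_sym (negbTE ji).
Qed.

Lemma simplex_stochastic (d : nat) (D : set 'rV[R]_d) k l
    (S : tuple_of R k d) (M : 'M[R]_(l.+1, k.+1)) :
  stochastic M -> simplex D S -> simplex D (M *m S).
Proof.
move=> [M0 M1] DS x [a [a0 a1 ->]]; apply: DS; exists (a *m M); split.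
- by move=> i; rewrite mxE sumr_ge0 // => l' _; rewrite mulr_ge0.
- under eq_bigr do rewrite mxE.
  by rewrite exchange_big /=; under eq_bigr do rewrite -mulr_sumr M1 mulr1.
- by rewrite mulmxA.
Qed.

Lemma simplex_row (d : nat) (D : set 'rV[R]_d) k (S : tuple_of R k d) i :
  simplex D S -> D (row i S).
Proof.
move=> DS; apply: DS; exists (delta_mx 0 i); split.
- by move=> j; rewrite mxE.
- rewrite (bigD1 i) //= big1 ?addr0; first by rewrite mxE !eqxx.
  by move=> j /negbTE ji; rewrite mxE ji andbF.
- by rewrite rowE.
Qed.

End Stochastic.

Section Midpoints.
Variable R : realType.
Implicit Types (d : nat).

Definition mid d (p q : 'rV[R]_d) : 'rV[R]_d := 2^-1 *: (p + q).

Definition vertex k d (S : tuple_of R k d) (i : nat) : 'rV[R]_d := row (inord i) S.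

(** The simplices needed below have midpoints of vertices of S as their vertices
    (a vertex being the midpoint of itself and itself); each of them is encoded by
    the list of its pairs of vertex indices. *)
Definition midpts (l : nat) (s : seq (nat * nat)) k d (S : tuple_of R k d) :
    tuple_of R l d :=
  \matrix_(i < l.+1)
    mid (vertex S (nth (0, 0)%N s i).1) (vertex S (nth (0, 0)%N s i).2).

Lemma midptsM l s k m d (M : 'M[R]_(k.+1, m)) (S : 'M[R]_(m, d)) :
  midpts l s (M *m S) = midpts l s M *m S.
Proof.
by apply/row_matrixP => i; rewrite row_mul !rowK /mid /vertex !row_mul
  -mulmxDl scalemxAl.
Qed.

Lemma midptsE l s k d (S : tuple_of R k d) : midpts l s S = midpts l s 1%:M *m S.
Proof. by rewrite -midptsM mul1mx. Qed.

Lemma stochastic_midpts l s k m (M : tuple_of R k m) :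
  stochastic M -> stochastic (midpts l s M).
Proof.
move=> [M0 M1]; split=> [i j|i].
  by rewrite !mxE mulr_ge0 // addr_ge0.
under eq_bigr do rewrite !mxE.
by rewrite -mulr_sumr big_split /= !M1 -[1 + 1]/2 mulVf.
Qed.

Lemma simplex_midpts l s k d D (S : tuple_of R k d) :
  simplex D S -> simplex D (midpts l s S).
Proof.
by move=> DS; rewrite midptsE; apply: simplex_stochastic => //;
  apply/stochastic_midpts/stochastic1.
Qed.

Lemma row_shrink k d n (S : tuple_of R k d) i :
  row i (shrink n S) = 2 ^- n *: row i S + (1 - 2 ^- n) *: row ord0 S.
Proof. by rewrite rowK linearZ. Qed.

Lemma shrinkM k m d n (M : 'M[R]_(k.+1, m)) (S : 'M[R]_(m, d)) :
  shrink n (M *m S) = shrink n M *m S.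
Proof.
by apply/row_matrixP => i; rewrite row_mul !row_shrink !row_mul mulmxDl !scalemxAl.
Qed.

Lemma shrink0 k d (S : tuple_of R k d) : shrink 0 S = S.
Proof.
by apply/row_matrixP => i; rewrite row_shrink expr0 invr1 subrr scale0r addr0 scale1r.
Qed.

Lemma shrink_shrink k d m n (S : tuple_of R k d) :
  shrink m (shrink n S) = shrink (m + n) S.
Proof.
apply/row_matrixP => i; rewrite !row_shrink -scalerDl subrKC scale1r.
rewrite scalerDr scalerA -addrA scalerA -scalerDl exprD invfM.
by congr (_ + _ *: _); ring.
Qed.

Lemma shrinkS k d n (S : tuple_of R k d) i :
  row i (shrink n.+1 S) = mid (row ord0 S) (row i (shrink n S)).
Proof.
rewrite !row_shrink /mid; apply/rowP => j; rewrite !mxE exprS invfM.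
by move: (2 ^- n) => a; field.
Qed.

Lemma cvg_bigsum (T : Type) (I : eqType) (F : set_system T) (r : seq I)
    (f : I -> T -> R) (a : I -> R) :
  Filter F -> (forall i, i \in r -> f i @ F --> a i) ->
  (fun t => \sum_(i <- r) f i t) @ F --> \sum_(i <- r) a i.
Proof.
move=> FF; elim: r => [|i r IH] fa.
  by rewrite big_nil; under eq_cvg do rewrite big_nil; apply: cvg_cst.
rewrite big_cons; under eq_cvg do rewrite big_cons.
apply: cvgD; first by apply: fa; rewrite inE eqxx.
by apply: IH => j jr; apply: fa; rewrite inE jr orbT.
Qed.

Lemma cvg_mx m n (T : Type) (F : set_system T) (f : T -> 'M[R]_(m, n)) (A : 'M[R]_(m, n)) :
  Filter F -> (forall i j, (fun t => f t i j) @ F --> A i j) -> f @ F --> A.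
Proof.
move=> FF fA B [P AP sPB]; rewrite nbhs_filterE.
have : \forall t \near F, forall i j, P i j (f t i j).
  by apply: filter_forall => i; apply: filter_forall => j; apply: fA; apply: AP.
by apply: filterS => t Pt; apply: sPB.
Qed.

Lemma cvg_mulmx m n p (T : Type) (F : set_system T) (M : 'M[R]_(m, n))
    (f : T -> 'M[R]_(n, p)) (A : 'M[R]_(n, p)) :
  Filter F -> f @ F --> A -> (fun t => M *m f t) @ F --> M *m A.
Proof.
move=> FF fA; apply: cvg_mx => i j; rewrite mxE; under eq_cvg do rewrite mxE.
apply: cvg_bigsum => l _; apply: cvgMl_tmp.
exact: (cvg_comp f (fun B : 'M[R]_(n, p) => B l j) fA (@coord_continuous R n p l j A)).
Qed.

Definition dist2 d (x y : 'rV[R]_d) : R := \sum_i (x 0 i - y 0 i) ^+ 2.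

Lemma dist2_eq0 d (x y : 'rV[R]_d) : dist2 x y = 0 -> x = y.
Proof.
move/eqP; rewrite psumr_eq0 => [/allP xy|i _]; last exact: sqr_ge0.
apply/rowP => i; have := xy i; rewrite mem_index_enum => /(_ isT).
by rewrite sqrf_eq0 subr_eq0 => /eqP.
Qed.

Lemma dist2_mid d (w p q : 'rV[R]_d) :
  dist2 w (mid p q) = dist2 w p / 2 + dist2 w q / 2 - dist2 p q / 4.
Proof.
rewrite /dist2 !mulr_suml -big_split -sumrB; apply: eq_bigr => i _ /=.
by rewrite !mxE; field.
Qed.

(** A point is determined by its distances to two points when these are both half
    the distance of the two points, by the parallelogram identity [dist2_mid].  Thus
    a distance-preserving map, affine or not, preserves midpoints. *)
Lemma isometry_mid d (f : 'rV[R]_d -> 'rV[R]_d) p q :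
  (forall x y, eucl_dist (f x) (f y) = eucl_dist x y) ->
  f (mid p q) = mid (f p) (f q).
Proof.
move=> iso_f; have f2 x y : dist2 (f x) (f y) = dist2 x y.
  have sq a b : dist2 a b = eucl_dist a b ^+ 2 :> R.
    by rewrite sqr_sqrtr // sumr_ge0 // => i _; apply: sqr_ge0.
  by rewrite !sq iso_f.
have sym x y : dist2 x y = dist2 y x :> R.
  by apply: eq_bigr => i _; rewrite -opprB sqrrN.
have d0 x : dist2 x x = 0 :> R by apply: big1 => i _; rewrite subrr expr0n.
apply: dist2_eq0; rewrite dist2_mid !f2 ![dist2 (mid p q) _]sym !dist2_mid !d0.
by rewrite [dist2 q p]sym; field.
Qed.

Lemma isometric_midpts l s k d (S S' : tuple_of R k d) :
  isometric S S' -> isometric (midpts l s S) (midpts l s S').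
Proof.
move=> [f [iso_f fS]]; exists f; split=> // j; rewrite !rowK isometry_mid //.
by rewrite /vertex !fS.
Qed.

(** Homothety of ratio 2 ^- n towards the first vertex iterates midpoints. *)
Lemma isometric_shrink n k d (S S' : tuple_of R k d) :
  isometric S S' -> isometric (shrink n S) (shrink n S').
Proof.
move=> [f [iso_f fS]]; exists f; split=> //; elim: n => [|n IH] j.
  by rewrite !shrink0.
by rewrite !shrinkS isometry_mid // fS IH.
Qed.

Lemma isometric_affine k d (S S' : tuple_of R k d) (e : R) b :
  e ^+ 2 = 1 -> (forall j, row j S' = e *: row j S + b) -> isometric S S'.
Proof.
move=> e1 S'E; exists (fun x => e *: x + b); split=> // x y.
rewrite /eucl_dist; congr Num.sqrt; apply: eq_bigr => i _; rewrite !mxE.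
have -> : e * x 0 i + b 0 i - (e * y 0 i + b 0 i) = e * (x 0 i - y 0 i) by ring.
by rewrite exprMn e1 mul1r.
Qed.

Lemma isometric_homothetic n k d (S S' : tuple_of R k d) (e : R) b :
  e ^+ 2 = 1 -> (forall j, row j S' = (e * 2 ^- n) *: row j S + b) ->
  isometric (shrink n S) S'.
Proof.
move=> e1 S'E; apply: (@isometric_affine _ _ _ _ e (b - (e * (1 - 2 ^- n)) *: row ord0 S)) => //.
move=> j; rewrite row_shrink S'E; apply/rowP => i; rewrite !mxE; ring.
Qed.

Lemma isometric_midpts_shrink n l s k d (S : tuple_of R k d) :
  isometric (shrink n (midpts l s S)) (midpts l s (shrink n S)).
Proof.
apply: (@isometric_homothetic _ _ _ _ _ 1 ((1 - 2 ^- n) *: row ord0 S)); first by rewrite expr1n.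
move=> j; rewrite !rowK /mid /vertex !row_shrink; apply/rowP => i; rewrite !mxE.
by move: (2 ^- n) => a; field.
Qed.

Lemma isometric_row'_shrink n k d (S : tuple_of R k.+1 d) i :
  isometric (shrink n (row' i S)) (row' i (shrink n S)).
Proof.
apply: (@isometric_homothetic _ _ _ _ _ 1 ((1 - 2 ^- n) *: row ord0 S)); first by rewrite expr1n.
by move=> j; apply/rowP => m; rewrite !mxE; ring.
Qed.

Lemma isometric_row' k d (S S' : tuple_of R k.+1 d) i :
  isometric S S' -> isometric (row' i S) (row' i S').
Proof.
move=> [f [iso_f fS]]; exists f; split=> // j.
have row'E (A : tuple_of R k.+1 d) : row j (row' i A) = row (lift i j) A.
  by apply/rowP => m; rewrite !mxE.
by rewrite !row'E.
Qed.

Lemma vol_eq0 k d (S : tuple_of R k d) :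
  (vol S == 0) = (\det (edge_mx S *m (edge_mx S)^T) <= 0).
Proof.
by rewrite /vol mulf_eq0 invr_eq0 pnatr_eq0 eqn0Ngt fact_gt0 sqrtr_eq0.
Qed.

Lemma vol_homothetic k d (S S' : tuple_of R k d) (a : R) b :
  (forall j, row j S' = a *: row j S + b) -> vol S = 0 -> vol S' = 0.
Proof.
move=> S'E /eqP; rewrite vol_eq0 => S0; apply/eqP; rewrite vol_eq0.
have -> : edge_mx S' = a *: edge_mx S.
  by apply/row_matrixP => j; rewrite linearZ /= !rowK !S'E;
     apply/rowP => i; rewrite !mxE; ring.
rewrite linearZ /= -scalemxAr -scalemxAl scalerA detZ.
by rewrite mulr_ge0_le0 // exprn_ge0 // -expr2 sqr_ge0.
Qed.

End Midpoints.

(** * Tails of the Dini series *)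

Section Tail.
Variables (R : realType) (d : nat) (D : set 'rV[R]_d) (j k : nat) (u : germ R j d).
Local Notation term S := (dini_term k%:R u S).

Definition tail (n : nat) (S : tuple_of R j d) : R :=
  dini_sum k%:R u S - series (term S) n.

Lemma dini_termE S n : term S n = (2 ^+ k) ^+ n * u (shrink n S).
Proof. by rewrite /dini_term -natrM powR_mulrn // mulnC exprM. Qed.

Lemma term_shrink S m n : (2 ^+ k) ^+ n * term (shrink n S) m = term S (m + n).
Proof. by rewrite !dini_termE shrink_shrink mulrA -exprD addnC. Qed.

Lemma tail0 S : tail 0 S = dini_sum k%:R u S.
Proof. by rewrite /tail /series /= big_geq // subr0. Qed.

Hypothesis u_sdini : strong_dini D k%:R u.

Lemma gauge_ge0 S : simplex D S -> 0 <= u S.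
Proof. by case: u_sdini => -[[u0 _] _] _; apply: u0. Qed.

Lemma gauge_isometric S S' : simplex D S -> simplex D S' -> isometric S S' -> u S = u S'.
Proof. by case: u_sdini => -[[_ uu] _] _; apply: uu. Qed.

Lemma term_ge0 S n : simplex D S -> 0 <= term S n.
Proof.
by move=> DS; rewrite dini_termE mulr_ge0 ?exprn_ge0 // gauge_ge0 //; apply: shrink_simplex.
Qed.

Lemma term_isometric S S' : simplex D S -> simplex D S' -> isometric S S' ->
  term S = term S'.
Proof.
move=> DS DS' SS'; apply/funext => n; rewrite !dini_termE; congr (_ * _).
by apply: gauge_isometric; [exact: shrink_simplex..|exact: isometric_shrink].
Qed.

Lemma dini_sum_isometric S S' : simplex D S -> simplex D S' -> isometric S S' ->
  dini_sum k%:R u S = dini_sum k%:R u S'.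
Proof. by move=> DS DS' SS'; rewrite /dini_sum (term_isometric DS DS' SS'). Qed.

Lemma cvg_series_term S : simplex D S -> series (term S) @ \oo --> dini_sum k%:R u S.
Proof. by case: u_sdini => _ H /H. Qed.

Lemma series_le_sum S n : simplex D S -> series (term S) n <= dini_sum k%:R u S.
Proof.
move=> DS; apply: nondecreasing_cvgn_le; last exact: (cvgP _ (cvg_series_term DS)).
by apply: nondecreasing_series => i _ _; apply: term_ge0.
Qed.

Lemma term_le_tail S n m : simplex D S -> (n <= m)%N -> term S m <= tail n S.
Proof.
move=> DS nm; rewrite lerBrDl (le_trans _ (series_le_sum m.+1 DS)) //.
rewrite {2}/series /= big_nat_recr //= lerD2r.
rewrite /series /= [leRHS](big_cat_nat (leq0n n) nm) //= lerDl sumr_ge0 // => i _.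
exact: term_ge0.
Qed.

Lemma tail_anti S n m : simplex D S -> (n <= m)%N -> tail m S <= tail n S.
Proof.
move=> DS nm; rewrite lerD2l lerN2 /series /= [leRHS](big_cat_nat (leq0n n) nm) //=.
by rewrite lerDl sumr_ge0 // => i _; apply: term_ge0.
Qed.

Lemma tail_ge0 S n : simplex D S -> 0 <= tail n S.
Proof. by move=> DS; rewrite subr_ge0 series_le_sum. Qed.

Lemma cvg_tail S : simplex D S -> tail^~ S @ \oo --> (0 : R).
Proof.
move=> DS; rewrite -(subrr (dini_sum k%:R u S)).
by apply: cvgB; [exact: cvg_cst | exact: cvg_series_term].
Qed.

(** Shrinking S shifts its Dini series by n terms. *)
Lemma dini_sum_shrink S n : simplex D S ->
  (2 ^+ k) ^+ n * dini_sum k%:R u (shrink n S) = tail n S.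
Proof.
move=> DS; have DnS := shrink_simplex (n := n) DS.
have e : (fun m => (2 ^+ k) ^+ n * series (term (shrink n S)) m) =
    (fun m => series (term S) (m + n)%N - series (term S) n).
  apply/funext => m; rewrite /series /= mulr_sumr.
  rewrite [LHS](eq_bigr (fun i => term S (i + n)%N)); last by move=> i _; apply: term_shrink.
  rewrite [X in X - _](big_cat_nat (leq0n n) (leq_addl m n)) //= addrAC subrr add0r.
  by rewrite -{2}[n]add0n big_addn addnK.
have l1 : (fun m => (2 ^+ k) ^+ n * series (term (shrink n S)) m) @ \oo -->
    (2 ^+ k) ^+ n * dini_sum k%:R u (shrink n S).
  by apply: cvgMl_tmp; apply: cvg_series_term.
have l2 : (fun m => series (term S) (m + n)%N - series (term S) n) @ \oo --> tail n S.
  apply: cvgB; last exact: cvg_cst.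
  by have := cvg_series_term DS; rewrite -(cvg_shiftn n).
by apply: (cvg_unique _ l1); rewrite // e.
Qed.

Lemma tail_continuous n : germ_continuous D u -> germ_continuous D (dini_sum k%:R u) ->
  germ_continuous D (tail n).
Proof.
move=> uc sc Sn S DSn DS SnS; apply: cvgB; first exact: sc.
rewrite /series /=; apply: cvg_bigsum => i _; under eq_cvg do rewrite dini_termE.
rewrite dini_termE; apply: cvgMl_tmp; apply: uc.
- by move=> m; apply: shrink_simplex.
- exact: shrink_simplex.
- rewrite -[S]mul1mx shrinkM; under eq_cvg do rewrite -[Sn _]mul1mx shrinkM.
  exact: cvg_mulmx.
Qed.

End Tail.

(** Sequential continuity at S gives continuity in terms of balls, by choosing a
    counterexample in each ball of radius 1/(n+1). *)
Lemma germ_continuous_ball (R : realType) d (D : set 'rV[R]_d) k (g : germ R k d) S e :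
  germ_continuous D g -> simplex D S -> 0 < e ->
  exists2 del, 0 < del & forall S', simplex D S' -> ball S del S' -> `|g S - g S'| < e.
Proof.
move=> gc DS e0; apply: contrapT => nex.
have H n : exists S', [/\ simplex D S', ball S n.+1%:R^-1 S' & e <= `|g S - g S'|].
  apply: contrapT => nS'; apply: nex; exists n.+1%:R^-1 => [|S' DS' SS'].
    by rewrite invr_gt0 ltr0n.
  by rewrite ltNge; apply/negP => ge; apply: nS'; exists S'.
have {nex} /choice[Sn SnP] := H.
have SnS : Sn @ \oo --> S.
  apply/cvg_ballP => r r0; near=> n; have [_ SSn _] := SnP n.
  by apply: le_ball SSn; apply: ltW; near: n; apply: (near_infty_natSinv_lt (PosNum r0)).
have /cvgrPdist_lt/(_ e e0) := gc Sn S (fun n => let: And3 a _ _ := SnP n in a) DS SnS.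
case=> N _ /(_ N (leqnn N)) /=; have [_ _] := SnP N.
by rewrite leNgt => /negP.
Unshelve. all: by end_near. Qed.

(** * Uniform convergence of the Dini series on the simplices inside a simplex *)

Section CompactStochastic.
Variable R : realType.

Lemma cvg_vec_mx_mul m n p (S : 'M[R]_(n, p)) (v : 'rV[R]_(m * n)) :
  (fun x => vec_mx x *m S) @ v --> vec_mx v *m S.
Proof.
have nF : Filter (nbhs v) by exact: nbhs_filter.
apply: (@cvg_mx R m p _ (nbhs v)) => i j; rewrite mxE; under eq_cvg do rewrite mxE.
apply: cvg_bigsum => l _; apply: cvgMr_tmp; rewrite mxE; under eq_cvg do rewrite mxE.
exact: (@coord_continuous R _ _ ord0 _ v).
Qed.

Lemma compact_stochastic m n :
  compact [set v : 'rV[R]_(m * n) | stochastic (vec_mx v)].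
Proof.
pose rowsum i (v : 'rV[R]_(m * n)) : R := \sum_(j < n) v ord0 (mxvec_index i j).
have -> : [set v : 'rV[R]_(m * n) | stochastic (vec_mx v)] =
    [set v : 'rV[R]_(m * n) | forall i, `[0, 1]%classic (v ord0 i)] `&`
    \bigcap_(i in [set: 'I_m]) (rowsum i @^-1` [set x | x = 1]).
  apply/seteqP; split=> v /=.
    move=> [v0 v1]; split=> [l|i _].
      case/mxvec_indexP: l => i j; have := v0 i j; have := v1 i.
      rewrite mxE in_itv /= => <- -> /=; rewrite (bigD1 j) //= mxE lerDl sumr_ge0 //.
    by rewrite /= /rowsum -(v1 i); apply: eq_bigr => j _; rewrite mxE.
  move=> [v0 v1]; split=> i => [j|].
    by rewrite mxE; have := v0 (mxvec_index i j); rewrite in_itv /= => /andP[].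
  by rewrite -(v1 i I); apply: eq_bigr => j _; rewrite mxE.
apply: compact_closedI.
  exact: (@rV_compact R _ (fun=> `[0, 1]%classic) (fun=> @segment_compact R 0 1)).
apply: closed_bigI => i _; apply: closed_comp; last exact: closed_eq.
move=> v _; have nF : Filter (nbhs v) by exact: nbhs_filter.
apply: (@cvg_bigsum R _ _ (nbhs v)) => j _; exact: (@coord_continuous R _ _ ord0 _ v).
Qed.

End CompactStochastic.

(** Dini's theorem: the tails are continuous, decrease to 0 with n, and the
    stochastic matrices form a compact set. *)
Lemma tail_uniform (R : realType) d (D : set 'rV[R]_d) j k p (u : germ R j d)
    (S : tuple_of R p d) (e : R) :
  strong_dini D k%:R u -> germ_continuous D u -> germ_continuous D (dini_sum k%:R u) ->
  simplex D S -> 0 < e ->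
  exists n0, forall n, (n0 <= n)%N -> forall M : 'M[R]_(j.+1, p.+1),
    stochastic M -> tail k u n (M *m S) <= e.
Proof.
move=> ud uc sc DS e0; have e2 : 0 < e / 2 by rewrite divr_gt0.
have := @compact_stochastic R j.+1 p.+1.
move=> /compact_near_coveringP/near_covering_withinP cov.
have [|n0 _ H] := cov nat \oo (fun n v => tail k u n (vec_mx v *m S) <= e) _ _.
  move=> v sv; have DvS := simplex_stochastic sv DS.
  have [n0 _ tl] := cvgr_lt _ (cvg_tail ud DvS) _ e2.
  have := @tail_continuous R d D j k u n0 uc sc.
  move=> /germ_continuous_ball/(_ DvS e2)[del del0 ball_del].
  exists ([set v' | ball (vec_mx v *m S) del (vec_mx v' *m S)], [set n | (n0 <= n)%N]).
    split; last by exists n0.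
    by have /cvg_ballP/(_ _ del0) := @cvg_vec_mx_mul R _ _ _ S v.
  move=> [v' n] /= [bv' n0n] sv'; have Dv'S := simplex_stochastic sv' DS.
  apply: le_trans (tail_anti ud Dv'S n0n) _.
  have := ball_del _ Dv'S bv'; rewrite ltr_norml => /andP[h _].
  have := tl n0 (leqnn _); lra.
exists n0 => n n0n M sM; have := H n n0n (mxvec M); rewrite /= mxvecK; exact.
Qed.

(** The sequence a + s is nondecreasing and bounded, hence convergent; so a is the
    difference of two convergent sequences. *)
Lemma cvg_small_increments (R : realType) (a s : nat -> R) (L : R) :
  (forall n, `|a n - a n.+1| <= s n.+1 - s n) -> s @ \oo --> L ->
  cvgn a /\ forall n, `|a n - limn a| <= L - s n.
Proof.
move=> as_ sL.
have s_nd : nondecreasing_seq s.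
  by apply/nondecreasing_seqP => n; rewrite -subr_ge0 (le_trans _ (as_ n)).
have sle n : s n <= L.
  by rewrite -(cvg_lim _ sL) //; apply: nondecreasing_cvgn_le => //; apply: cvgP sL.
have inc n m : `|a n - a (m + n)%N| <= s (m + n)%N - s n.
  elim: m => [|m IH]; first by rewrite add0n !subrr normr0.
  rewrite -(subrKA (a (m + n)%N)) (le_trans (ler_normD _ _)) //.
  by have := IH; have := as_ (m + n)%N; rewrite addSn; lra.
have b_cvg : cvgn (fun n => a n + s n).
  apply: nondecreasing_is_cvgn.
    by apply/nondecreasing_seqP => n; have := as_ n; rewrite ler_norml => /andP[? ?]; lra.
  exists (a 0 - s 0 + 2 * L) => _ [n _ <-].
  by have := inc 0 n; rewrite addn0 ler_norml => /andP[h _]; have := sle n; lra.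
have a_cvg : cvgn a.
  have -> : a = (fun n => a n + s n) - s by apply/funext => n; rewrite !fctE addrK.
  by apply: is_cvgB => //; apply: cvgP sL.
split=> // n.
have l1 : (fun m => `|a n - a (m + n)%N|) @ \oo --> `|a n - limn a|.
  apply: cvg_norm; apply: cvgB; first exact: cvg_cst.
  by have := a_cvg; rewrite -(cvg_shiftn n).
have l2 : (fun m => s (m + n)%N - s n) @ \oo --> L - s n.
  by apply: cvgB; [have := sL; rewrite -(cvg_shiftn n) | exact: cvg_cst].
by apply: (ler_cvg_to l1 l2); apply: nearW.
Qed.

(** * Sewing by iterated subdivision *)

Section Sewing.
Variables (R : realType) (k : nat) (pieces fills : seq (seq (nat * nat))).

Definition subdivide d (w : germ R k d) : germ R k d :=
  fun S => \sum_(l <- pieces) w (midpts k l S).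

Arguments subdivide {d} w S.

Hypothesis size_pieces : size pieces = (2 ^ k)%N.
Hypothesis pieces_half : forall l, l \in pieces ->
  forall d (S : tuple_of R k d), exists e b,
    e ^+ 2 = 1 /\ forall i, row i (midpts k l S) = (e * 2^-1) *: row i S + b.
Hypothesis defect_le_fills : forall d D (w : germ R k d) S,
  simplex D S -> nonatomic D w ->
  `|w S - subdivide w S| <= \sum_(l <- fills) `|delta w (midpts k.+1 l S)|.

Variables (d : nat) (D : set 'rV[R]_d).
Implicit Types (S : tuple_of R k d).

Lemma iter_subdivide_le n (f g : germ R k d) :
  (forall S, simplex D S -> `|f S| <= g S) ->
  forall S, simplex D S -> `|iter n subdivide f S| <= iter n subdivide g S.
Proof.
move=> fg; elim: n => //= n IH S DS; rewrite (le_trans (ler_norm_sum _ _ _)) //.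
by apply: ler_sum => l _; apply: IH; apply: simplex_midpts.
Qed.

Lemma iter_subdivideB n (f g : germ R k d) S :
  iter n subdivide f S - iter n subdivide g S =
  iter n subdivide (fun S => f S - g S) S.
Proof. by elim: n S => //= n IH S; rewrite -sumrB; apply: eq_bigr => l _; rewrite IH. Qed.

(** All the pieces of the n-th subdivision are isometric to the shrunk simplex. *)
Lemma iter_subdivide_uniform n (g : germ R k d) S :
  uniform_gauge D g -> simplex D S ->
  iter n subdivide g S = (2 ^+ k) ^+ n * g (shrink n S).
Proof.
move=> [_ gu]; elim: n S => [|n IH] S DS; first by rewrite shrink0 mul1r.
rewrite iterS {1}/subdivide.
transitivity (\sum_(l <- pieces) (2 ^+ k) ^+ n * g (shrink n.+1 S)).
  apply: eq_big_seq => l lc; rewrite IH; last exact: simplex_midpts.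
  congr (_ * _); apply/esym; rewrite -[n.+1]addn1 -shrink_shrink; apply: gu.
  - by do 2!apply: shrink_simplex.
  - by apply: shrink_simplex; apply: simplex_midpts.
  - apply: isometric_shrink; have [e [b [e1 H]]] := pieces_half lc S.
    exact: (isometric_homothetic (n := 1) e1 H).
rewrite big_const_seq count_predT size_pieces iter_addr_0 -[LHS]mulr_natl natrX mulrA.
by rewrite -exprS.
Qed.

Variable u : germ R k.+1 d.
Hypothesis u_sdini : strong_dini D k%:R u.
Hypothesis u_cont : germ_continuous D u.
Hypothesis usum_cont : germ_continuous D (dini_sum k%:R u).

(** The gauge v of the theorem. *)
Definition weight : germ R k d :=
  fun S => \sum_(l <- fills) dini_sum k%:R u (midpts k.+1 l S).

Definition weight_tail n : germ R k d :=
  fun S => \sum_(l <- fills) tail k u n (midpts k.+1 l S).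

Lemma weight_tail0 S : weight_tail 0 S = weight S.
Proof. by apply: eq_bigr => l _; rewrite tail0. Qed.

Lemma weight_uniform : uniform_gauge D weight.
Proof.
split=> [S DS|S S' DS DS' SS'].
  apply: sumr_ge0 => l _; rewrite -(tail0 k u).
  by apply: (tail_ge0 u_sdini); apply: simplex_midpts.
apply: eq_bigr => l _; apply: (dini_sum_isometric u_sdini); try exact: simplex_midpts.
exact: isometric_midpts.
Qed.

Lemma weight_shrink n S : simplex D S ->
  (2 ^+ k) ^+ n * weight (shrink n S) = weight_tail n S.
Proof.
move=> DS; rewrite /weight mulr_sumr; apply: eq_bigr => l _.
rewrite -(dini_sum_shrink u_sdini); last exact: simplex_midpts.
congr (_ * _); apply/esym; apply: (dini_sum_isometric u_sdini).
- by apply: shrink_simplex; apply: simplex_midpts.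
- by apply: simplex_midpts; apply: shrink_simplex.
- exact: isometric_midpts_shrink.
Qed.

Lemma cvg_weight_tail S : simplex D S -> weight_tail^~ S @ \oo --> (0 : R).
Proof.
move=> DS; have -> : 0 = \sum_(l <- fills) (0 : R) by rewrite big1.
by apply: cvg_bigsum => l _; apply: (cvg_tail u_sdini); apply: simplex_midpts.
Qed.

Lemma weight_dini : dini D k%:R weight.
Proof.
split=> [|S DS]; first exact: weight_uniform.
have -> : dini_term k%:R weight S = weight_tail^~ S.
  by apply/funext => n; rewrite dini_termE weight_shrink.
exact: cvg_weight_tail.
Qed.

Lemma cvg_midpts l s (Sn : nat -> tuple_of R k d) S :
  Sn @ \oo --> S -> (fun n => midpts l s (Sn n)) @ \oo --> midpts l s S.
Proof.
by move=> SnS; rewrite midptsE; under eq_cvg do rewrite midptsE; apply: cvg_mulmx.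
Qed.

Lemma weight_tail_continuous n : germ_continuous D (weight_tail n).
Proof.
move=> Sn S DSn DS SnS; apply: cvg_bigsum => l _.
apply: (tail_continuous (n := n) u_cont usum_cont).
- by move=> m; apply: simplex_midpts.
- exact: simplex_midpts.
- exact: cvg_midpts.
Qed.

Lemma weight_continuous : germ_continuous D weight.
Proof.
by have -> : weight = weight_tail 0; [apply/funext => S; rewrite weight_tail0
  | apply: weight_tail_continuous].
Qed.

Variable w : germ R k d.
Hypothesis w_cont : germ_continuous D w.
Hypothesis w_nonatomic : nonatomic D w.

Definition sew : germ R k d := fun S => limn (fun n => iter n subdivide w S).

Section Bound.
Variable c : R.
Hypothesis c_ge0 : 0 <= c.
Hypothesis delta_w : forall T : tuple_of R k.+1 d, simplex D T -> `|delta w T| <= c * u T.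

(** Each of the n-th pieces contributes at most c times the value of u on its
    filling simplices; by uniformity these values add up to n-th Dini terms, and an
    n-th term is the difference of two consecutive tails. *)
Lemma iter_subdivide_step n S : simplex D S ->
  `|iter n subdivide w S - iter n.+1 subdivide w S| <=
  c * (weight_tail n S - weight_tail n.+1 S).
Proof.
move=> DS; rewrite iterSr iter_subdivideB.
pose g S := c * \sum_(l <- fills) u (midpts k.+1 l S).
have g_unif : uniform_gauge D g.
  split=> [S' DS'|S' S'' DS' DS'' iso].
    by rewrite mulr_ge0 // sumr_ge0 // => l _; apply: (gauge_ge0 u_sdini); apply: simplex_midpts.
  congr (_ * _); apply: eq_bigr => l _; apply: (gauge_isometric u_sdini).
  - exact: simplex_midpts.
  - exact: simplex_midpts.
  - exact: isometric_midpts.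
apply: le_trans (@iter_subdivide_le n _ g _ _ DS) _.
  move=> S' DS'; apply: le_trans (defect_le_fills DS' w_nonatomic) _.
  rewrite /g mulr_sumr; apply: ler_sum => l _.
  by apply: delta_w; apply: simplex_midpts.
rewrite iter_subdivide_uniform // mulrCA; apply: ler_wpM2l => //.
rewrite /weight_tail -sumrB mulr_sumr; apply: ler_sum => l _.
have -> : tail k u n (midpts k.+1 l S) - tail k u n.+1 (midpts k.+1 l S) =
    dini_term k%:R u (midpts k.+1 l S) n.
  by rewrite -[RHS]seriesSB /tail; ring.
rewrite dini_termE le_eqVlt; apply/orP; left; apply/eqP.
congr (_ * _); apply/esym; apply: (gauge_isometric u_sdini).
- by apply: shrink_simplex; apply: simplex_midpts.
- by apply: simplex_midpts; apply: shrink_simplex.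
- exact: isometric_midpts_shrink.
Qed.

Lemma sew_cvg_dist S : simplex D S ->
  cvgn (fun n => iter n subdivide w S) /\
  forall n, `|iter n subdivide w S - sew S| <= c * weight_tail n S.
Proof.
move=> DS; have l0 : (fun n => - (c * weight_tail n S)) @ \oo --> - (c * 0).
  by apply: cvgN; apply: cvgMl_tmp; apply: cvg_weight_tail.
have inc n : `|iter n subdivide w S - iter n.+1 subdivide w S| <=
    - (c * weight_tail n.+1 S) - - (c * weight_tail n S).
  by rewrite opprK [leRHS]addrC -mulrBr; apply: iter_subdivide_step.
have [cv H] := cvg_small_increments inc l0.
by split=> // n; have := H n; rewrite mulr0 oppr0 opprK add0r.
Qed.

Lemma sew_dist S : simplex D S -> `|w S - sew S| <= c * weight S.
Proof. by move=> DS; have [_ /(_ 0)] := sew_cvg_dist DS; rewrite weight_tail0. Qed.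

Lemma sew_subdivide S : simplex D S -> sew S = subdivide sew S.
Proof.
move=> DS; have [cv _] := sew_cvg_dist DS.
have l1 : (fun n => iter n.+1 subdivide w S) @ \oo --> sew S.
  by have := cv; rewrite -cvg_shiftS.
apply: (cvg_unique _ l1) => //; apply: cvg_bigsum => l _.
have DlS : simplex D (midpts k l S) by exact: simplex_midpts.
by have [] := sew_cvg_dist DlS.
Qed.

Lemma iter_subdivide_continuous n : germ_continuous D (iter n subdivide w).
Proof.
elim: n => //= n IH Sn S DSn DS SnS; apply: cvg_bigsum => l _; apply: IH.
- by move=> m; apply: simplex_midpts.
- exact: simplex_midpts.
- exact: cvg_midpts.
Qed.

(** Locally uniform convergence: the error c times [weight_tail N] is itself
    continuous, so that it stays small near S when it is small at S. *)
Lemma sew_continuous : germ_continuous D sew.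
Proof.
move=> Sn S DSn DS SnS; apply/cvgrPdist_lt => e e0.
have e3 : 0 < e / 3 by rewrite divr_gt0.
have l0 : (fun n => c * weight_tail n S) @ \oo --> c * 0.
  by apply: cvgMl_tmp; apply: cvg_weight_tail.
rewrite mulr0 in l0; have [N _ /(_ N (leqnn N)) /= cN] := cvgr_lt _ l0 _ e3.
have l1 : (fun n => c * weight_tail N (Sn n)) @ \oo --> c * weight_tail N S.
  by apply: cvgMl_tmp; apply: weight_tail_continuous.
have l2 := @iter_subdivide_continuous N _ _ DSn DS SnS.
near=> n.
have [_ /(_ N) h1] := sew_cvg_dist DS; have [_ /(_ N) h2] := sew_cvg_dist (DSn n).
have h3 : c * weight_tail N (Sn n) < e / 3 by near: n; apply: (cvgr_lt _ l1).
have h4 : `|iter N subdivide w S - iter N subdivide w (Sn n)| < e / 3.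
  by near: n; move/cvgrPdist_lt: l2; apply.
move: h1 h2 h4; rewrite !ler_norml !ltr_norml.
by move=> /andP[? ?] /andP[? ?] /andP[? ?]; apply/andP; split; lra.
Unshelve. all: by end_near. Qed.

Lemma sew_nonatomic : nonatomic D sew.
Proof.
have na n : nonatomic D (iter n subdivide w).
  elim: n => //= n IH S DS S0; rewrite /subdivide big_seq big1 // => l lc.
  have [e [b [_ H]]] := pieces_half lc S.
  by apply: IH; [exact: simplex_midpts | exact: vol_homothetic H S0].
move=> S DS S0; rewrite /sew.
have -> : (fun n => iter n subdivide w S) = fun=> 0 by apply/funext => n; apply: na.
exact: lim_cst.
Qed.

Lemma row'_mulmx m n p (i : 'I_m.+1) (M : 'M[R]_(m.+1, n)) (A : 'M[R]_(n, p)) :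
  row' i (M *m A) = row' i M *m A.
Proof. by apply/matrixP => a b; rewrite !mxE; apply: eq_bigr => j _; rewrite mxE. Qed.

Lemma stochastic_row' m n (i : 'I_m.+1) (M : 'M[R]_(m.+1, n)) :
  stochastic M -> stochastic (row' i M).
Proof.
move=> [M0 M1]; split=> [a b|a]; first by rewrite mxE.
by rewrite -(M1 (lift i a)); apply: eq_bigr => b _; rewrite mxE.
Qed.

(** On a (k+1)-simplex of size 2 ^- n inside S, delta w is at most c u, and
    sew w - w is at most c v on each of its k.+2 faces.  The simplex and its faces
    are translates of shrunk simplices inside S, so, multiplied by 2 ^ (n k), these
    bounds are sums of tails of Dini series, uniformly small by [tail_uniform]. *)
Lemma delta_sew_small S e : simplex D S -> 0 < e ->
  exists n0, forall n, (n0 <= n)%N ->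
  forall (M M' : 'M[R]_(k.+2, k.+1)) b, stochastic M -> stochastic M' ->
    (forall i, row i M = 2 ^- n *: row i M' + b) ->
    `|delta sew (M *m S)| <= e / (2 ^+ k) ^+ n.
Proof.
move=> DS e0.
(* One Dini term of u and, for each of the k.+2 faces, one tail per filling
   simplex; the summand 1 makes C positive when c = 0. *)
pose C : R := c * (1 + (k.+2 * size fills)%:R) + 1.
have C0 : 0 < C by rewrite ltr_wpDl // mulr_ge0 // addr_ge0.
have [n0 H] := tail_uniform u_sdini u_cont usum_cont DS (divr_gt0 e0 C0).
exists n0 => n n0n M M' b sM sM' MM'.
have DM := simplex_stochastic sM DS; have DM' := simplex_stochastic sM' DS.
have iso : isometric (shrink n (M' *m S)) (M *m S).
  apply: (@isometric_homothetic _ _ _ _ _ _ 1 (b *m S)); first by rewrite expr1n.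
  by move=> i; rewrite !row_mul MM' mulmxDl scalemxAl mul1r.
have p0 : 0 < (2 ^+ k) ^+ n :> R by rewrite !exprn_gt0.
rewrite ler_pdivlMr // mulrC.
have u_small : (2 ^+ k) ^+ n * u (M *m S) <= e / C.
  rewrite -(gauge_isometric u_sdini (shrink_simplex DM') DM iso) -dini_termE.
  exact: le_trans (term_le_tail u_sdini DM' (leqnn n)) (H n n0n _ sM').
have w_small i : (2 ^+ k) ^+ n * weight (row' i (M *m S)) <= (e / C) *+ size fills.
  have DrM : simplex D (row' i (M *m S)).
    by rewrite row'_mulmx; apply: simplex_stochastic => //; apply: stochastic_row'.
  have DrM' : simplex D (row' i (M' *m S)).
    by rewrite row'_mulmx; apply: simplex_stochastic => //; apply: stochastic_row'.
  have [_ /(_ (shrink n (row' i (M' *m S))) (row' i (M *m S))) <- //] := weight_uniform; first last.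
  - have [f [f1 f2]] := isometric_row'_shrink n (M' *m S) i.
    have [g [g1 g2]] := isometric_row' i iso.
    exists (g \o f); split=> [x y|j]; first by rewrite /= g1 f1.
    by rewrite /= f2 g2.
  - exact: shrink_simplex.
  rewrite weight_shrink //.
  apply: (@le_trans _ _ (\sum_(l <- fills) e / C)); last first.
    by rewrite big_const_seq count_predT iter_addr_0.
  apply: ler_sum => l _; rewrite row'_mulmx midptsM; apply: H => //.
  by apply: stochastic_midpts; apply: stochastic_row'.
have -> : delta sew (M *m S) = delta w (M *m S) -
    \sum_(i < k.+2) (-1) ^+ i * (w (row' i (M *m S)) - sew (row' i (M *m S))).
  by rewrite /delta -sumrB; apply: eq_bigr => i _; ring.
apply: (@le_trans _ _ (c * (e / C) + \sum_(i < k.+2) c * ((e / C) *+ size fills))).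
  rewrite -(gtr0_norm p0) -normrM mulrBr (le_trans (ler_normB _ _)) //.
  rewrite !normrM (gtr0_norm p0); apply: lerD.
    apply: le_trans (_ : (2 ^+ k) ^+ n * (c * u (M *m S)) <= _).
      by rewrite ler_pM2l // delta_w.
    by rewrite mulrCA ler_wpM2l.
  apply: le_trans (ler_wpM2l (ltW p0) (ler_norm_sum _ _ _)) _.
  rewrite mulr_sumr; apply: ler_sum => i _.
  rewrite normrM normrX normrN1 expr1n mul1r.
  apply: le_trans (_ : (2 ^+ k) ^+ n * (c * weight (row' i (M *m S))) <= _).
    rewrite ler_pM2l //; apply: sew_dist.
    by rewrite row'_mulmx; apply: simplex_stochastic => //; apply: stochastic_row'.
  by rewrite mulrCA ler_wpM2l.
rewrite sumr_const card_ord -[_ *+ k.+2]mulr_natr -[_ *+ size fills]mulr_natr.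
have -> : c * (e / C) + c * (e / C * (size fills)%:R) * k.+2%:R = (C - 1) / C * e.
  by rewrite {3}/C addrK natrM; ring.
by rewrite ler_piMl ?(ltW e0) // ler_pdivrMr // mul1r gerBl.
Qed.

End Bound.
End Sewing.

(** * The dyadic subdivisions of a segment and of a triangle *)

Section Lists.
Variable R : realType.

Definition rows_mx n d (s : seq 'rV[R]_d) : 'M[R]_(n, d) := \matrix_(i < n) nth 0 s i.

Lemma row_rows_mx n d (s : seq 'rV[R]_d) i : row i (rows_mx n s) = nth 0 s i.
Proof. by rewrite rowK. Qed.

Lemma rows_mx_mul n m d (s : seq 'rV[R]_m) (A : 'M[R]_(m, d)) :
  rows_mx n s *m A = rows_mx n [seq x *m A | x <- s].
Proof.
apply/row_matrixP => i; rewrite row_mul !row_rows_mx.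
have [lt|ge] := ltnP i (size s); first by rewrite (nth_map 0).
by rewrite !nth_default ?size_map // mul0mx.
Qed.

Lemma row'_rows_mx n d (s : seq 'rV[R]_d) (i : 'I_n.+1) :
  row' i (rows_mx n.+1 s) = rows_mx n (take i s ++ drop i.+1 s).
Proof.
apply/row_matrixP => j; rewrite row_rows_mx.
have -> : row j (row' i (rows_mx n.+1 s)) = nth 0 s (lift i j).
  by rewrite -row_rows_mx; apply/rowP => l; rewrite !mxE.
rewrite nth_cat size_take /= /bump; case: (ltnP i (size s)) => [is_|si].
  case: (ltnP j i) => ij; first by rewrite nth_take.
  by rewrite nth_drop addSn subnKC.
rewrite (take_oversize si) (drop_oversize (leqW si)) /=.
case: (ltnP j (size s)) => js; first by rewrite leqNgt (leq_trans js si).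
by rewrite nth_nil nth_default // (leq_trans js) // leq_addl.
Qed.

Lemma row_vertex k d (S : tuple_of R k d) i : row i S = vertex S i.
Proof. by rewrite /vertex inord_val. Qed.

Lemma rows_mxE1 d (S : tuple_of R 1 d) : S = rows_mx 2 [:: vertex S 0; vertex S 1].
Proof.
apply/row_matrixP => i; rewrite row_rows_mx; case: i => [[|[|]]] //= i;
by rewrite row_vertex.
Qed.

Lemma rows_mxE2 d (S : tuple_of R 2 d) : S = rows_mx 3 [:: vertex S 0; vertex S 1; vertex S 2].
Proof.
apply/row_matrixP => i; rewrite row_rows_mx; case: i => [[|[|[|]]]] //= i;
by rewrite row_vertex.
Qed.

Lemma rows_mxE3 d (S : tuple_of R 3 d) :
  S = rows_mx 4 [:: vertex S 0; vertex S 1; vertex S 2; vertex S 3].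
Proof.
apply/row_matrixP => i; rewrite row_rows_mx; case: i => [[|[|[|[|]]]]] //= i;
by rewrite row_vertex.
Qed.

Lemma vertex_rows_mx k d (s : seq 'rV[R]_d) i : (i <= k)%N ->
  vertex (rows_mx k.+1 s) i = nth 0 s i.
Proof. by move=> ik; rewrite /vertex row_rows_mx inordK. Qed.

Lemma delta_rows_mx1 d (w : germ R 1 d) a b c :
  delta w (rows_mx 3 [:: a; b; c]) =
  w (rows_mx 2 [:: b; c]) - w (rows_mx 2 [:: a; c]) + w (rows_mx 2 [:: a; b]).
Proof.
rewrite /delta !big_ord_recl big_ord0 !row'_rows_mx /= addr0 expr0 mul1r expr1 mulN1r.
by rewrite -signr_odd /= mul1r addrA.
Qed.

Lemma delta_rows_mx2 d (w : germ R 2 d) a b c e :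
  delta w (rows_mx 4 [:: a; b; c; e]) =
  w (rows_mx 3 [:: b; c; e]) - w (rows_mx 3 [:: a; c; e]) + w (rows_mx 3 [:: a; b; e]) -
  w (rows_mx 3 [:: a; b; c]).
Proof.
rewrite /delta !big_ord_recl big_ord0 !row'_rows_mx /= addr0 expr0 mul1r expr1 mulN1r.
rewrite -[(-1) ^+ bump 0 (bump 0 0)]signr_odd /= mul1r.
by rewrite -[(-1) ^+ _]signr_odd /= expr1 mulN1r !addrA.
Qed.

Lemma midpts_rows_mx l s k d (S : tuple_of R k d) : size s = l.+1 ->
  midpts l s S = rows_mx l.+1 [seq mid (vertex S a.1) (vertex S a.2) | a <- s].
Proof.
by move=> sl; apply/row_matrixP => i; rewrite row_rows_mx rowK (nth_map (0, 0)%N) // sl.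
Qed.

Lemma mid_refl d (p : 'rV[R]_d) : mid p p = p.
Proof. by rewrite /mid; apply/rowP => i; rewrite !mxE; field. Qed.

Lemma vol1_refl d (p : 'rV[R]_d) : vol (rows_mx 2 [:: p; p]) = 0.
Proof.
apply/eqP; rewrite vol_eq0; have -> : edge_mx (rows_mx 2 [:: p; p]) = 0.
  apply/row_matrixP => i; rewrite rowK !row_rows_mx row0 /=.
  by case: i => [[|]] //= i; rewrite subrr.
by rewrite mul0mx det0.
Qed.

(** The edge matrix of three collinear points factors through a column, so its
    Gram matrix has rank at most 1. *)
Lemma vol2_collinear d (x v : 'rV[R]_d) (a b c : R) :
  vol (rows_mx 3 [:: x + a *: v; x + b *: v; x + c *: v]) = 0.
Proof.
apply/eqP; rewrite vol_eq0.
set S := rows_mx _ _.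
have -> : edge_mx S = (\col_(i < 2) [:: b - a; c - a]`_i) *m v.
  apply/matrixP => i l; rewrite !mxE big_ord1 !mxE.
  by case: i => [[|[|]]] //= i; rewrite !mxE; ring.
set C := \col_i _; rewrite -mulmxA le_eqVlt; apply/orP; left.
apply: contraT => det_neq0.
have : row_free (C *m (v *m (C *m v)^T)) by rewrite row_free_unit unitmxE unitfE.
have r1 := leq_trans (mxrankM_maxl C (v *m (C *m v)^T)) (rank_leq_col C).
by rewrite /row_free => /eqP r2; rewrite r2 in r1.
Qed.

Lemma conv_hull_row k d (S : tuple_of R k d) i : conv_hull S (row i S).
Proof. exact: (@simplex_row R d (conv_hull S)). Qed.

(** Simplices inside a simplex in D are in D, because a convex combination of
    convex combinations is one. *)
Lemma simplex_hull (d : nat) (D : set 'rV[R]_d) k l (S : tuple_of R k d) (T : tuple_of R l d) :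
  (forall i, conv_hull S (row i T)) -> simplex D S -> simplex D T.
Proof.
move=> ST DS; have [a aP] := choice ST.
have -> : T = (\matrix_i a i) *m S.
  by apply/row_matrixP => i; rewrite row_mul rowK; have [_ _ ->] := aP i.
apply: simplex_stochastic => //; split=> [i j|i].
  by rewrite mxE; have [a0 _ _] := aP i.
by have [_ <- _] := aP i; apply: eq_bigr => j _; rewrite mxE.
Qed.

Lemma collinear_nonatomic d (D : set 'rV[R]_d) (w : germ R 2 d) x v a b c S :
  nonatomic D w -> simplex D S ->
  S = rows_mx 3 [:: x + a *: v; x + b *: v; x + c *: v] -> w S = 0.
Proof. by move=> na DS SE; apply: na => //; rewrite SE; apply: vol2_collinear. Qed.

End Lists.

Section Schemes.
Variable R : realType.

Definition pieces1 : seq (seq (nat * nat)) :=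
  [:: [:: (0, 0); (0, 1)]; [:: (0, 1); (1, 1)]]%N.

Definition fills1 : seq (seq (nat * nat)) := [:: [:: (0, 0); (0, 1); (1, 1)]]%N.

(** The four pieces, with vertices ordered as in [quarter]. *)
Definition pieces2 : seq (seq (nat * nat)) :=
  [:: [:: (0, 0); (0, 1); (0, 2)]; [:: (0, 1); (1, 1); (1, 2)];
      [:: (0, 2); (1, 2); (2, 2)]; [:: (1, 2); (0, 2); (0, 1)]]%N.

(** With a, b, c the midpoints opposite to p, q, r, the six tetrahedra p q a r,
    p c q a, p a b r, b a b r, p c a b and c a b c lead from p q r to its four pieces
    by cutting along pa, ac and ab, and then exchanging the diagonals of p c a b.
    The two with a repeated vertex correct orderings of vertices: w is not assumed
    to be alternating. *)
Definition fills2 : seq (seq (nat * nat)) :=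
  let p := (0, 0)%N in let q := (1, 1)%N in let r := (2, 2)%N in
  let a := (1, 2)%N in let b := (0, 2)%N in let c := (0, 1)%N in
  [:: [:: p; q; a; r]; [:: p; c; q; a]; [:: p; a; b; r];
      [:: b; a; b; r]; [:: p; c; a; b]; [:: c; a; b; c]].

Lemma pieces1_half l : l \in pieces1 ->
  forall d (S : tuple_of R 1 d), exists e b,
    e ^+ 2 = 1 /\ forall i, row i (midpts 1 l S) = (e * 2^-1) *: row i S + b.
Proof.
move=> lc d S; exists 1; move: lc; rewrite !inE.
case/orP => /eqP->; [exists (2^-1 *: vertex S 0)|exists (2^-1 *: vertex S 1)];
(split; first by rewrite expr1n);
move=> i; rewrite midpts_rows_mx // row_rows_mx (row_vertex S i); case: i => [[|[|]]] //= _;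
by apply/rowP => j; rewrite !mxE; ring.
Qed.

Lemma pieces2_half l : l \in pieces2 ->
  forall d (S : tuple_of R 2 d), exists e b,
    e ^+ 2 = 1 /\ forall i, row i (midpts 2 l S) = (e * 2^-1) *: row i S + b.
Proof.
move=> lc d S; move: lc; rewrite !inE.
case/or4P => /eqP->; [exists 1, (2^-1 *: vertex S 0)|exists 1, (2^-1 *: vertex S 1)
  |exists 1, (2^-1 *: vertex S 2)
  |exists (-1), (2^-1 *: (vertex S 0 + vertex S 1 + vertex S 2))];
(split; first by rewrite ?sqrrN expr1n);
move=> i; rewrite midpts_rows_mx // row_rows_mx (row_vertex S i); case: i => [[|[|[|]]]] //= _;
by apply/rowP => j; rewrite !mxE; ring.
Qed.

Lemma defect1_le_fills d (D : set 'rV[R]_d) (w : germ R 1 d) S :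
  simplex D S -> nonatomic D w ->
  `|w S - subdivide pieces1 w S| <= \sum_(l <- fills1) `|delta w (midpts 2 l S)|.
Proof.
move=> _ _; rewrite big_seq1 /subdivide !big_cons big_nil addr0 !midpts_rows_mx //=.
rewrite !mid_refl delta_rows_mx1 {1}[S]rows_mxE1 -normrN; set x := w _.
by rewrite le_eqVlt; apply/orP; left; apply/eqP; congr `|_|; ring.
Qed.

Lemma delta_midpts2 d (w : germ R 2 d) (S : tuple_of R 2 d) x y z t :
  delta w (midpts 3 [:: x; y; z; t] S) =
  w (midpts 2 [:: y; z; t] S) - w (midpts 2 [:: x; z; t] S) +
  w (midpts 2 [:: x; y; t] S) - w (midpts 2 [:: x; y; z] S).
Proof. by rewrite !midpts_rows_mx //= delta_rows_mx2. Qed.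

Lemma defect2_le_fills d (D : set 'rV[R]_d) (w : germ R 2 d) S :
  simplex D S -> nonatomic D w ->
  `|w S - subdivide pieces2 w S| <= \sum_(l <- fills2) `|delta w (midpts 3 l S)|.
Proof.
move=> DS na.
pose W l := w (midpts 2 l S).
have W0 x v (e f g : R) l : size l = 3 ->
    [seq mid (vertex S a.1) (vertex S a.2) | a <- l] =
      [:: x + e *: v; x + f *: v; x + g *: v] -> W l = 0.
  move=> sl lE; apply: (@collinear_nonatomic _ _ _ _ x v e f g _ na).
    exact: simplex_midpts.
  by rewrite midpts_rows_mx // lE.
have side i j : W [:: (i, i); (i, j); (j, j)] = 0.
  apply: (@W0 (vertex S i) (vertex S j - vertex S i) 0 2^-1 1) => //=.
  by congr [:: _; _; _]; apply/rowP => l; rewrite !mxE; field.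
have side' i j : W [:: (i, i); (j, i); (j, j)] = 0.
  apply: (@W0 (vertex S i) (vertex S j - vertex S i) 0 2^-1 1) => //=.
  by congr [:: _; _; _]; apply/rowP => l; rewrite !mxE; field.
have ends x y : W [:: x; y; x] = 0.
  pose m a := mid (vertex S a.1) (vertex S a.2).
  apply: (@W0 (m x) (m y - m x) 0 1 0) => //=.
  by congr [:: _; _; _]; apply/rowP => l; rewrite !mxE; field.
have left x y : W [:: x; x; y] = 0.
  pose m a := mid (vertex S a.1) (vertex S a.2).
  apply: (@W0 (m x) (m y - m x) 0 0 1) => //=.
  by congr [:: _; _; _]; apply/rowP => l; rewrite !mxE; field.
have wE : w S = W [:: (0, 0); (1, 1); (2, 2)]%N.
  by rewrite /W midpts_rows_mx //= !mid_refl -rows_mxE2.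
rewrite /subdivide !big_cons !big_nil !addr0 !delta_midpts2 wE -!/(W _) !(side, side', ends, left).
set w1 := W [:: (0, 0); (1, 1); (2, 2)]%N.
have tri (a b c e f g : R) : `|a - b + c - e - f - g| <=
   `|a| + (`|b| + (`|c| + (`|e| + (`|f| + `|g|)))).
  rewrite !addrA; do 3![apply: le_trans (ler_normB _ _) _; rewrite lerD2r].
  by apply: le_trans (ler_normD _ _) _; rewrite lerD2r; apply: ler_normB.
apply: le_trans (tri _ _ _ _ _ _); rewrite le_eqVlt; apply/orP; left; apply/eqP.
by congr `|_|; ring.
Qed.

End Schemes.

(** * The sewn germ is closed on a segment and on a triangle *)

Section Flat.
Variables (R : realType) (d : nat) (D : set 'rV[R]_d).

(** M and M' hold barycentric coordinates with respect to S of a (k+1)-simplex of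
    size 2 ^- n and of a homothetic one of size 1: delta w is o(2 ^ (- n k)) at
    scale 2 ^- n, uniformly over the simplices inside S. *)
Definition coplanar_small k (w : germ R k d) : Prop :=
  forall S e, simplex D S -> 0 < e ->
  exists n0, forall n, (n0 <= n)%N ->
  forall (M M' : 'M[R]_(k.+2, k.+1)) b, stochastic M -> stochastic M' ->
    (forall i, row i M = 2 ^- n *: row i M' + b) ->
    `|delta w (M *m S)| <= e / (2 ^+ k) ^+ n.

Lemma exists_minimum (s : seq R) : s != [::] ->
  exists2 m, m \in s & {in s, forall x, m <= x}.
Proof.
elim: s => // x [|y s] IH _; first by exists x; rewrite ?inE // => z; rewrite inE => /eqP->.
have [//|m ms mle] := IH; have [xm|mx] := leP x m.
  exists x; first by rewrite inE eqxx.
  by move=> z; rewrite inE => /predU1P[->//|/mle]; apply: le_trans.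
exists m; first by rewrite inE ms orbT.
by move=> z; rewrite inE => /predU1P[->|/mle//]; apply: ltW.
Qed.

Section Segment.
(** Barycentric coordinates of the point of abscissa x of a segment. *)
Definition bary1 (x : R) : 'rV[R]_2 := \row_i [:: 1 - x; x]`_i.

Lemma stochastic_bary1 n (s : seq R) : size s = n ->
  {in s, forall x, unit_itv x} -> stochastic (rows_mx n (map bary1 s)).
Proof.
move=> sn us; have u (i : 'I_n) : unit_itv s`_i by apply: us; rewrite mem_nth // sn.
split=> [i j|i].
  rewrite mxE (nth_map 0) ?sn // mxE; have /andP[? ?] := u i.
  by case: j => [[|[|]]] //= _; lra.
under eq_bigr do rewrite mxE (nth_map 0) ?sn // mxE.
by rewrite !big_ord_recl big_ord0 /=; lra.
Qed.

Lemma stochastic2E m (M : 'M[R]_(m, 2)) i : stochastic M ->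
  row i M = bary1 (M i ord_max) /\ unit_itv (M i ord_max).
Proof.
move=> [M0 M1]; have := M1 i; rewrite !big_ord_recl big_ord0 addr0.
have -> : lift ord0 ord0 = ord_max :> 'I_2 by apply/val_inj.
move=> s1; have := M0 i ord0; have := M0 i ord_max => h1 h0; split.
  apply/rowP => j; rewrite !mxE; case: j => [[|[|]]] //= j.
    by rewrite -s1 addrK; congr (M _ _); apply/val_inj.
  by congr (M _ _); apply/val_inj.
by rewrite /unit_itv h1 -s1 lerDr.
Qed.

Variable w : germ R 1 d.
Hypothesis w_na : nonatomic D w.
Hypothesis w_subdivide : forall S, simplex D S -> w S = subdivide pieces1 w S.
Hypothesis w_small : coplanar_small w.

(** In the coordinate [bary1], w becomes a germ to which [line_closed] applies. *)
Lemma closed_on_segment (S : tuple_of R 1 d) (M : 'M[R]_(3, 2)) :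
  simplex D S -> stochastic M -> delta w (M *m S) = 0.
Proof.
move=> DS sM; pose g x y := w (rows_mx 2 [:: bary1 x; bary1 y] *m S).
have Dg x y : unit_itv x -> unit_itv y -> simplex D (rows_mx 2 [:: bary1 x; bary1 y] *m S).
  move=> ux uy; apply: simplex_stochastic => //.
  by apply: (@stochastic_bary1 _ [:: x; y]) => // z; rewrite !inE => /orP[]/eqP->.
have deltaE x y z : delta w (rows_mx 3 [:: bary1 x; bary1 y; bary1 z] *m S) = delta1 g x y z.
  by rewrite rows_mx_mul delta_rows_mx1 /delta1 /g !rows_mx_mul.
have [r0 u0] := stochastic2E (inord 0) sM; have [r1 u1] := stochastic2E (inord 1) sM.
have [r2 u2] := stochastic2E (inord 2) sM.
rewrite [M]rows_mxE2 /vertex r0 r1 r2 deltaE; apply: line_closed => //.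
- move=> x ux; apply: w_na; first exact: Dg.
  by rewrite rows_mx_mul /=; apply: vol1_refl.
- move=> x y ux uy; rewrite /g w_subdivide; last exact: Dg.
  have midE a b : mid (bary1 a) (bary1 b) = bary1 ((a + b) / 2).
    by apply/rowP => -[[|[|]]] //= i; rewrite !mxE /=; field.
  rewrite /subdivide !big_cons big_nil addr0 /bisect !midptsM !midpts_rows_mx //=.
  by rewrite !vertex_rows_mx //= !mid_refl midE.
- move=> e e0; have [n0 H] := w_small DS e0; exists n0 => n n0n x y z ux uy uz cl.
  have [|m ms mle] := @exists_minimum [:: x; y; z]; first by [].
  pose sc a := 2 ^+ n * (a - m).
  have e2 : 2 ^+ n != 0 :> R by rewrite expf_neq0.
  have p2 : 0 < 2 ^+ n :> R by rewrite exprn_gt0.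
  rewrite -deltaE; have := H n n0n _ (rows_mx 3 (map bary1 (map sc [:: x; y; z])))
    (\row_i [:: 1 - m - 2 ^- n; m]`_i).
  rewrite expr1; apply.
  + by apply: (@stochastic_bary1 _ [:: x; y; z]) => // a; rewrite !inE => /or3P[]/eqP->.
  + apply: stochastic_bary1; first by rewrite size_map.
    move=> _ /mapP[a ain ->]; rewrite /unit_itv /sc mulr_ge0 ?(ltW p2) ?subr_ge0 ?mle //=.
    by rewrite -ler_pdivlMl // mulr1; apply: le_trans (cl _ _ ain ms); apply: ler_norm.
  + move=> i; rewrite !row_rows_mx; case: i => [[|[|[|]]]] //= _;
    by apply/rowP => -[[|[|]]] //= j; rewrite !mxE /= /sc; field.
Qed.

End Segment.

Section PlaneTriangle.
(** Barycentric coordinates for which the triangle is 0 <= y <= x <= 1, with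
    vertices (0, 0), (1, 0) and (1, 1). *)
Definition bary2 (p : R * R) : 'rV[R]_3 := \row_i [:: 1 - p.1; p.1 - p.2; p.2]`_i.

Lemma stochastic_bary2 n (s : seq (R * R)) : size s = n ->
  {in s, forall p, in_tri p} -> stochastic (rows_mx n (map bary2 s)).
Proof.
move=> sn us; have u (i : 'I_n) : in_tri (nth 0 s i) by apply: us; rewrite mem_nth // sn.
split=> [i j|i].
  rewrite mxE (nth_map 0) ?sn // mxE; have [? ? ?] := u i.
  by case: j => [[|[|[|]]]] //= _; lra.
under eq_bigr do rewrite mxE (nth_map 0) ?sn // mxE.
by rewrite !big_ord_recl big_ord0 /=; lra.
Qed.

Lemma stochastic3E m (M : 'M[R]_(m, 3)) i : stochastic M ->
  exists2 p, row i M = bary2 p & in_tri p.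
Proof.
move=> [M0 M1]; have := M1 i; rewrite !big_ord_recl big_ord0 addr0.
set a := M i _; set b := M i _; set c := M i _ => s1.
have [a0 b0 c0] : [/\ 0 <= a, 0 <= b & 0 <= c] by split; apply: M0.
exists (b + c, c); last by split=> /=; lra.
apply/rowP => j; rewrite !mxE; case: j => [[|[|[|]]]] //= j.
- by rewrite -s1 addrK; congr (M _ _); apply/val_inj.
- by rewrite addrK; congr (M _ _); apply/val_inj.
- by congr (M _ _); apply/val_inj.
Qed.

Variable w : germ R 2 d.
Hypothesis w_na : nonatomic D w.
Hypothesis w_subdivide : forall S, simplex D S -> w S = subdivide pieces2 w S.
Hypothesis w_small : coplanar_small w.

(** In the coordinates [bary2], w becomes a germ to which [triangle_closed] applies,
    also when S is degenerate. *)
Lemma closed_on_triangle (S : tuple_of R 2 d) (M : 'M[R]_(4, 3)) :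
  simplex D S -> stochastic M -> delta w (M *m S) = 0.
Proof.
move=> DS sM; pose g x y z := w (rows_mx 3 [:: bary2 x; bary2 y; bary2 z] *m S).
have Dg x y z : in_tri x -> in_tri y -> in_tri z ->
    simplex D (rows_mx 3 [:: bary2 x; bary2 y; bary2 z] *m S).
  move=> ux uy uz; apply: simplex_stochastic => //.
  by apply: (@stochastic_bary2 _ [:: x; y; z]) => // p; rewrite !inE => /or3P[]/eqP->.
have deltaE x y z t : delta w (rows_mx 4 [:: bary2 x; bary2 y; bary2 z; bary2 t] *m S) =
    delta2 g x y z t.
  by rewrite rows_mx_mul delta_rows_mx2 /delta2 /g !rows_mx_mul.
have g0 x y z u v a b c : in_tri x -> in_tri y -> in_tri z ->
    [:: bary2 x *m S; bary2 y *m S; bary2 z *m S] =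
    [:: u + a *: v; u + b *: v; u + c *: v] -> g x y z = 0.
  move=> tx ty tz E; apply: (@collinear_nonatomic _ _ D _ u v a b c _ w_na); first exact: Dg.
  by rewrite rows_mx_mul /= E.
have [p0 r0 t0] := stochastic3E (inord 0) sM; have [p1 r1 t1] := stochastic3E (inord 1) sM.
have [p2 r2 t2] := stochastic3E (inord 2) sM; have [p3 r3 t3] := stochastic3E (inord 3) sM.
rewrite [M]rows_mxE3 /vertex r0 r1 r2 r3 deltaE; apply: triangle_closed => //.
- move=> p q tp tq.
  apply: (@g0 _ _ _ (bary2 p *m S) (bary2 q *m S - bary2 p *m S) 0 0 1) => //.
  by congr [:: _; _; _]; apply/rowP => i; rewrite !mxE; ring.
- move=> p q tp tq.
  apply: (@g0 _ _ _ (bary2 p *m S) (bary2 q *m S - bary2 p *m S) 0 1 1) => //.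
  by congr [:: _; _; _]; apply/rowP => i; rewrite !mxE; ring.
- move=> p q tp tq.
  apply: (@g0 _ _ _ (bary2 p *m S) (bary2 q *m S - bary2 p *m S) 0 1 0) => //.
  by congr [:: _; _; _]; apply/rowP => i; rewrite !mxE; ring.
- move=> [x1 x2] [y1 y2] [z1 z2] tx ty tz /= x20 y20 z20.
  pose v : 'rV[R]_3 := \row_i [:: -1; 1; 0]`_i.
  apply: (@g0 _ _ _ (bary2 (0, 0) *m S) (v *m S) x1 y1 z1) => //.
  rewrite !scalemxAl -!mulmxDl x20 y20 z20.
  by congr [:: _ *m S; _ *m S; _ *m S]; apply/rowP => -[[|[|[|]]]] //= i; rewrite !mxE /=; ring.
- move=> p q r tp tq tr; rewrite /g [RHS]w_subdivide; last exact: Dg.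
  have midE a b : mid (bary2 a) (bary2 b) = bary2 (midp a b).
    by apply/rowP => -[[|[|[|]]]] //= i; rewrite !mxE /=; field.
  rewrite /subdivide !big_cons big_nil addr0 /quarter !midptsM !midpts_rows_mx //=.
  by rewrite !vertex_rows_mx //= !mid_refl !midE !addrA.
- move=> e e0; have e4 : 0 < e / 4 by rewrite divr_gt0.
  have [n0 H] := w_small DS e4; exists n0.+1 => -[//|n] n0n x y z t tx ty tz tt cl.
  pose s := [:: x; y; z; t].
  have [|m1 /mapP[q1 q1s ->] mle1] := @exists_minimum [seq p.1 | p <- s]; first by [].
  have [|m2 /mapP[q2 q2s ->] mle2] := @exists_minimum [seq p.2 | p <- s]; first by [].
  (* A square of side 1/2 fits into the triangle with its lower left corner at
     (1/2, 0); so a simplex of size 2 ^- n.+1 is enlarged by 2 ^+ n only. *)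
  pose sc (a : R * R) : R * R := (2 ^+ n * (a.1 - q1.1) + 1 / 2, 2 ^+ n * (a.2 - q2.2)).
  have e2 : 2 ^+ n != 0 :> R by rewrite expf_neq0.
  have pos2 : 0 < 2 ^+ n :> R by rewrite exprn_gt0.
  rewrite -deltaE; have := H n n0n _ (rows_mx 4 (map bary2 (map sc s)))
    (\row_i [:: 1 - q1.1 - 2 ^- n / 2; q1.1 - q2.2 - 2 ^- n / 2; q2.2]`_i).
  have -> : e / 4 / (2 ^+ 2) ^+ n = e / 4 ^+ n.+1.
    have -> : 2 ^+ 2 = 4 :> R by ring.
    rewrite exprS invfM; ring.
  apply.
  + by apply: (@stochastic_bary2 _ s) => // a; rewrite !inE => /or4P[]/eqP->.
  + apply: stochastic_bary2; first by rewrite size_map.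
    move=> _ /mapP[a ain ->].
    have [c1 _] := cl _ _ ain q1s; have [_ c2] := cl _ _ ain q2s.
    have l1 : 0 <= a.1 - q1.1 by rewrite subr_ge0 mle1 // map_f.
    have l2 : 0 <= a.2 - q2.2 by rewrite subr_ge0 mle2 // map_f.
    have h : 2 ^- n.+1 = (2 ^+ n)^-1 / 2 :> R by rewrite exprS invfM mulrC.
    have u1 : 2 ^+ n * (a.1 - q1.1) <= 1 / 2.
      by rewrite -ler_pdivlMl // mul1r -h; apply: le_trans c1; apply: ler_norm.
    have u2 : 2 ^+ n * (a.2 - q2.2) <= 1 / 2.
      by rewrite -ler_pdivlMl // mul1r -h; apply: le_trans c2; apply: ler_norm.
    have k1 : 0 <= 2 ^+ n * (a.1 - q1.1) by rewrite mulr_ge0 // ltW.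
    have k2 : 0 <= 2 ^+ n * (a.2 - q2.2) by rewrite mulr_ge0 // ltW.
    by split=> /=; lra.
  + move=> i; rewrite !row_rows_mx; case: i => [[|[|[|[|]]]]] //= _;
    by apply/rowP => -[[|[|[|]]]] //= j; rewrite !mxE /= /sc; field.
Qed.

End PlaneTriangle.
End Flat.

(** * From simplices to affine planes *)

Lemma stochastic_delta (R : realType) n (j : 'I_n) :
  stochastic (delta_mx 0 j : 'rV[R]_n).
Proof.
split=> [a b|a]; first by rewrite mxE.
rewrite (bigD1 j) //= big1 ?addr0; first by rewrite mxE ord1 !eqxx.
by move=> b /negbTE bj; rewrite mxE bj andbF.
Qed.

Lemma stochastic_conv (R : realType) m n (s : R) (A B : 'M[R]_(m, n)) :
  0 <= s <= 1 -> stochastic A -> stochastic B ->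
  stochastic (s *: A + (1 - s) *: B).
Proof.
move=> /andP[s0 s1] [A0 A1] [B0 B1]; split=> [i j|i].
  by rewrite !mxE addr_ge0 // mulr_ge0 // subr_ge0.
under eq_bigr do rewrite !mxE.
by rewrite big_split /= -!mulr_sumr A1 B1; ring.
Qed.

Section Planes.
Variables (R : realType) (k d : nat) (D : set 'rV[R]_d) (w : germ R k d).
Hypothesis w_closed : forall (S : tuple_of R k d) (M : 'M[R]_(k.+2, k.+1)),
  simplex D S -> stochastic M -> delta w (M *m S) = 0.
Variables (I : set 'rV[R]_k) (phi : 'rV[R]_k -> 'rV[R]_d).
Hypothesis phi_affine : affine_on I phi.
Hypothesis phiD : forall x, I x -> D (phi x).

Lemma map_vertices_stochastic n m (M : 'M[R]_(n.+1, m.+1)) (S : tuple_of R m k) :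
  stochastic M -> simplex I S ->
  map_vertices phi (M *m S) = M *m map_vertices phi S.
Proof.
move=> sM IS; have [A [b phiE]] := phi_affine.
have rowI i : I (row i S) by apply: simplex_row.
apply/row_matrixP => i; rewrite row_mul !rowK phiE; last first.
  by apply: simplex_row; apply: simplex_stochastic.
have -> : map_vertices phi S = S *m A + const_mx 1 *m b.
  apply/row_matrixP => j; rewrite rowK phiE // linearD /= !row_mul.
  by congr (_ + _); apply/rowP => l; rewrite !mxE big_ord1 !mxE mul1r.
rewrite mulmxDr !row_mul mulmxA; congr (_ + _); rewrite mulmxA.
apply/rowP => l; rewrite mxE big_ord1 mxE.
have [_ M1] := sM; under eq_bigr do rewrite !mxE mulr1.
by rewrite M1 mul1r.
Qed.

Lemma simplex_map_vertices m (S : tuple_of R m k) :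
  simplex I S -> simplex D (map_vertices phi S).
Proof.
move=> IS x [a [a0 a1 ->]].
have sa : stochastic a by split=> [i|i]; rewrite ord1.
have -> : a *m map_vertices phi S = phi (a *m S).
  by rewrite -map_vertices_stochastic //; apply/rowP => j; rewrite mxE row_id.
by apply: phiD; apply: IS; exists a.
Qed.

Let delta_phi (S : tuple_of R k.+1 k) : R :=
  delta (fun T : tuple_of R k k => w (map_vertices phi T)) S.

Lemma delta_map_vertices (S : tuple_of R k.+1 k) :
  delta_phi S = delta w (map_vertices phi S).
Proof.
apply: eq_bigr => i _; congr (_ * w _); apply/matrixP => a b; rewrite !mxE.
by congr (phi _ _ _); apply/rowP => l; rewrite !mxE.
Qed.

(** If one of the k.+2 points is a convex combination of the others, then all of
    them lie in the simplex that the others span. *)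
Lemma delta_phi_hull (S : tuple_of R k.+1 k) (i : 'I_k.+2) (a : 'rV[R]_k.+2) :
  simplex I S -> stochastic a -> a 0 i = 0 -> row i S = a *m S -> delta_phi S = 0.
Proof.
move=> IS [a0 a1] ai Si.
pose T : tuple_of R k k := row' i S.
pose M : 'M[R]_(k.+2, k.+1) :=
  \matrix_j (if unlift i j is Some l then delta_mx 0 l else col' i a).
have IT : simplex I T.
  apply: simplex_hull IS => j; have -> : row j T = row (lift i j) S.
    by apply/rowP => l; rewrite !mxE.
  exact: conv_hull_row.
have sM : stochastic M.
  split=> [j l|j]; first by rewrite mxE; case: unliftP => *; rewrite mxE.
  under eq_bigr do rewrite mxE; case: unliftP => [l _|_].
    rewrite (bigD1 l) //= big1 ?addr0; first by rewrite mxE !eqxx.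
    by move=> m /negbTE ml; rewrite mxE ml andbF.
  have := a1 0; rewrite (bigD1_ord i) //= ai add0r => <-.
  by apply: eq_bigr => m _; rewrite mxE.
have SE : S = M *m T.
  apply/row_matrixP => j; rewrite row_mul rowK; case: unliftP => [l ->|->].
    by rewrite -rowE; apply/rowP => m; rewrite !mxE.
  rewrite Si; apply/rowP => m; rewrite !mxE (bigD1_ord i) //= ai mul0r add0r.
  by apply: eq_bigr => n _; rewrite !mxE.
rewrite delta_map_vertices SE map_vertices_stochastic //.
by apply: w_closed => //; apply: simplex_map_vertices.
Qed.

Lemma delta_phi_between (S : tuple_of R k.+1 k) (i j l : 'I_k.+2) (s : R) :
  simplex I S -> i != j -> i != l -> 0 <= s <= 1 ->
  row i S = s *: row j S + (1 - s) *: row l S -> delta_phi S = 0.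
Proof.
move=> IS ij il /andP[s0 s1] Si.
apply: (@delta_phi_hull _ i (s *: delta_mx 0 j + (1 - s) *: delta_mx 0 l)) => //.
- by apply: stochastic_conv; rewrite ?s0 //; apply: stochastic_delta.
- by rewrite !mxE (negbTE ij) (negbTE il) !andbF !mulr0 addr0.
- by rewrite mulmxDl -!scalemxAl -!rowE.
Qed.

(** One of three collinear points lies between the other two. *)
Lemma delta_phi_collinear (S : tuple_of R k.+1 k) (i j l : 'I_k.+2) (s : R) :
  simplex I S -> i != j -> i != l -> j != l ->
  row i S = s *: row j S + (1 - s) *: row l S -> delta_phi S = 0.
Proof.
move=> IS ij il jl Si.
have [s0|s0] := ltP s 0.
  have n0 : 1 - s != 0 by rewrite gt_eqF //; lra.
  apply: (@delta_phi_between S l i j (1 - s)^-1) => //; rewrite 1?eq_sym //.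
    have [p0 p1] : 0 < 1 - s /\ 1 <= 1 - s by split; lra.
    by rewrite invr_ge0 (ltW p0) invf_le1.
  by rewrite Si; apply/rowP => m; rewrite !mxE; field.
have [s1|s1] := leP s 1.
  by apply: (@delta_phi_between S i j l s) => //; rewrite s0.
have n0 : s != 0 by rewrite gt_eqF //; lra.
apply: (@delta_phi_between S j i l s^-1) => //; rewrite 1?eq_sym //.
  have p0 : 0 < s by lra.
  by rewrite invr_ge0 (ltW p0) invf_le1 // ltW.
by rewrite Si; apply/rowP => m; rewrite !mxE; field.
Qed.

End Planes.

Section ClosedOnPlanes.
Variables (R : realType) (d : nat) (D : set 'rV[R]_d).

Lemma closed_on_lines (w : germ R 1 d) :
  (forall (S : tuple_of R 1 d) (M : 'M[R]_(3, 2)),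
    simplex D S -> stochastic M -> delta w (M *m S) = 0) ->
  closed_on_planes D w.
Proof.
move=> wc I phi phi_aff phiD S IS.
have coll := delta_phi_collinear wc phi_aff phiD IS.
pose i0 : 'I_3 := ord0; pose i1 : 'I_3 := inord 1; pose i2 : 'I_3 := inord 2.
have [i01 i02 i12] : [/\ i0 != i1, i0 != i2 & i1 != i2].
  by split; apply/eqP => /(congr1 val); rewrite /= ?inordK.
have [e|ne] := eqVneq (S i1 0) (S i2 0).
  apply: (coll i1 i2 i0 1) => //; rewrite 1?eq_sym //.
  by apply/rowP => j; rewrite !mxE ord1 e; ring.
apply: (coll i0 i1 i2 ((S i0 0 - S i2 0) / (S i1 0 - S i2 0))) => //.
by apply/rowP => j; rewrite !mxE ord1; field; rewrite subr_eq0.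
Qed.

(** The rows of S, extended by a coordinate 1, are four vectors in a space of
    dimension three. *)
Lemma affine_dependence (S : 'M[R]_(4, 2)) :
  exists2 a : 'rV[R]_4, a != 0 & \sum_i a 0 i = 0 /\ a *m S = 0.
Proof.
pose A : 'M[R]_(4, 2 + 1) := row_mx S (const_mx 1).
have : ~~ row_free A by rewrite /row_free neq_ltn (leq_ltn_trans (rank_leq_col A)).
rewrite -kermx_eq0 => /rowV0Pn[a /sub_kermxP]; rewrite mul_mx_row => aA a0; exists a => //.
have e := row_mx0 R 1 2 1; rewrite -aA in e; move: e => /esym/eq_row_mx[e1 e2]; split => //.
transitivity ((a *m (const_mx 1 : 'cV_4)) 0 0); last by rewrite e2 mxE.
by rewrite mxE; apply: eq_bigr => i _; rewrite mxE mulr1.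
Qed.

Definition same_sign (a b : R) := (0 <= a /\ 0 <= b) \/ (a <= 0 /\ b <= 0).

(** The sign condition puts the crossing point of the two lines inside one of the
    two segments; the first condition says that the lines are not parallel. *)
Lemma balanced_pairing (a b c e : R) :
  a + b + c + e = 0 -> [\/ a != 0, b != 0, c != 0 | e != 0] ->
  [\/ a + b != 0 /\ (same_sign a b \/ same_sign c e),
      a + c != 0 /\ (same_sign a c \/ same_sign b e) |
      a + e != 0 /\ (same_sign a e \/ same_sign b c)].
Proof.
move=> sum0 nz.
have {nz} nz : [\/ a + b != 0, a + c != 0 | a + e != 0].
  case: (eqVneq (a + b) 0) => [ab|]; last by constructor 1.
  case: (eqVneq (a + c) 0) => [ac|]; last by constructor 2.
  constructor 3; apply/eqP => ae; have a0 : a = 0 by lra.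
  by case: nz => /eqP; apply; lra.
rewrite /same_sign; case: (leP 0 a) => a0; case: (leP 0 b) => b0;
case: (leP 0 c) => c0; case: (leP 0 e) => e0.
all: try by constructor 1; split; [apply/eqP => h; lra|];
  first [left; left; split; lra | left; right; split; lra
        |right; left; split; lra | right; right; split; lra].
all: try by constructor 2; split; [apply/eqP => h; lra|];
  first [left; left; split; lra | left; right; split; lra
        |right; left; split; lra | right; right; split; lra].
all: try by constructor 3; split; [apply/eqP => h; lra|];
  first [left; left; split; lra | left; right; split; lra
        |right; left; split; lra | right; right; split; lra].
all: case: nz => h; [constructor 1|constructor 2|constructor 3]; split => //;
  first [left; left; split; lra | left; right; split; lra
        |right; left; split; lra | right; right; split; lra].
Qed.

Definition on_line (x p q : 'rV[R]_2) := exists s, x = s *: p + (1 - s) *: q.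

Lemma same_sign_ratio a b : a + b != 0 -> same_sign a b -> 0 <= a / (a + b) <= 1.
Proof.
move=> ab [[a0 b0]|[a0 b0]].
  have p : 0 < a + b by rewrite lt0r ab addr_ge0.
  by rewrite ler_pdivrMr // mul1r lerDl b0 divr_ge0 // ltW.
have p : a + b < 0 by rewrite lt_def eq_sym ab /=; lra.
by rewrite ler_ndivrMr // mul1r gerDl b0 andbT -mulrNN -invrN divr_ge0 // ?oppr_ge0 // ltW.
Qed.

(** The two expressions of x come from splitting the affine dependence into its
    two halves and dividing by a + b = - (c + e). *)
Lemma crossing_point (H : set 'rV[R]_2) a b c e p q r t :
  (forall y z s, H y -> H z -> 0 <= s <= 1 -> H (s *: y + (1 - s) *: z)) ->
  [/\ H p, H q, H r & H t] ->
  a + b + c + e = 0 -> a *: p + b *: q + c *: r + e *: t = 0 ->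
  a + b != 0 /\ (same_sign a b \/ same_sign c e) ->
  exists x, [/\ H x, on_line x p q & on_line x r t].
Proof.
move=> Hconv [Hp Hq Hr Ht] sum0 comb0 [ab sgn].
have ce : c + e != 0 by apply: contra_neq ab => h; lra.
have xE : (a / (a + b)) *: p + (1 - a / (a + b)) *: q =
          (c / (c + e)) *: r + (1 - c / (c + e)) *: t.
  have bE : 1 - a / (a + b) = b / (a + b) by field.
  have eE : 1 - c / (c + e) = e / (c + e) by field.
  have ceE : c + e = - (a + b) by lra.
  rewrite bE eE ceE; apply/rowP => i; move/rowP/(_ i): comb0; rewrite !mxE => h.
  apply/eqP; rewrite -subr_eq0; apply/eqP.
  transitivity ((a * p 0 i + b * q 0 i + c * r 0 i + e * t 0 i) / (a + b)).
    by field.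
  by rewrite h mul0r.
exists ((a / (a + b)) *: p + (1 - a / (a + b)) *: q); split.
- case: sgn => sg; first by apply: Hconv => //; apply: same_sign_ratio.
  by rewrite xE; apply: Hconv => //; apply: same_sign_ratio.
- by exists (a / (a + b)).
- by exists (c / (c + e)).
Qed.

(** With x the crossing point of two lines through complementary pairs of the four
    points, delta delta = 0 applied to x and these points leaves four tuples that
    contain x together with a whole pair. *)
Lemma closed_on_2planes (w : germ R 2 d) :
  (forall (S : tuple_of R 2 d) (M : 'M[R]_(4, 3)),
    simplex D S -> stochastic M -> delta w (M *m S) = 0) ->
  closed_on_planes D w.
Proof.
move=> wc I phi phi_aff phiD S IS.
set wphi := fun T => w _.
pose V x y z t := delta wphi (rows_mx 4 [:: x; y; z; t]).
have V0 x y z t : simplex I (rows_mx 4 [:: x; y; z; t]) ->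
    [\/ on_line x y z, on_line x y t | on_line x z t] -> V x y z t = 0.
  move=> IT; have coll := delta_phi_collinear wc phi_aff phiD IT.
  pose i0 : 'I_4 := ord0; pose i1 : 'I_4 := inord 1.
  pose i2 : 'I_4 := inord 2; pose i3 : 'I_4 := inord 3.
  have [i01 i02 i03] : [/\ i0 != i1, i0 != i2 & i0 != i3].
    by split; apply/eqP => /(congr1 val); rewrite /= ?inordK.
  have [i12 i13 i23] : [/\ i1 != i2, i1 != i3 & i2 != i3].
    by split; apply/eqP => /(congr1 val); rewrite /= ?inordK.
  case=> -[s xE].
  - by apply: (coll i0 i1 i2 s) => //; rewrite !row_rows_mx /= !inordK.
  - by apply: (coll i0 i1 i3 s) => //; rewrite !row_rows_mx /= !inordK.
  - by apply: (coll i0 i2 i3 s) => //; rewrite !row_rows_mx /= !inordK.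
have [a a0 [sum_a comb_a]] := affine_dependence S.
pose p i := vertex S i.
have Hp i : conv_hull S (p i) by apply: conv_hull_row.
have Hconv y z s : conv_hull S y -> conv_hull S z -> 0 <= s <= 1 ->
    conv_hull S (s *: y + (1 - s) *: z).
  move=> [b [b0 b1 ->]] [c [c0 c1 ->]] s01.
  have [|| r0 r1] := @stochastic_conv R 1 4 s b c s01.
  - by split=> i; rewrite ord1.
  - by split=> i; rewrite ord1.
  by exists (s *: b + (1 - s) *: c); split=> [//|//|]; rewrite mulmxDl -!scalemxAl.
have key x : conv_hull S x ->
    [\/ on_line x (p 0%N) (p 1%N) /\ on_line x (p 2%N) (p 3%N),
        on_line x (p 0%N) (p 2%N) /\ on_line x (p 1%N) (p 3%N) |
        on_line x (p 0%N) (p 3%N) /\ on_line x (p 1%N) (p 2%N)] ->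
    delta wphi S = 0.
  move=> Hx lines.
  have sub y z t : conv_hull S y -> conv_hull S z -> conv_hull S t ->
      simplex I (rows_mx 4 [:: x; y; z; t]).
    by move=> Hy Hz Ht; apply: simplex_hull IS => i; rewrite row_rows_mx;
       case: i => [[|[|[|[|]]]]] //=.
  have -> : delta wphi S = V x (p 1%N) (p 2%N) (p 3%N) - V x (p 0%N) (p 2%N) (p 3%N) +
      V x (p 0%N) (p 1%N) (p 3%N) - V x (p 0%N) (p 1%N) (p 2%N).
    by rewrite [S in LHS]rows_mxE3 /V !delta_rows_mx2 -!/(p _); ring.
  have V0x i j l : [\/ on_line x (p i) (p j), on_line x (p i) (p l) | on_line x (p j) (p l)] ->
      V x (p i) (p j) (p l) = 0.
    by apply: V0; apply: sub.
  have [-> -> -> ->] : [/\ V x (p 1%N) (p 2%N) (p 3%N) = 0, V x (p 0%N) (p 2%N) (p 3%N) = 0,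
      V x (p 0%N) (p 1%N) (p 3%N) = 0 & V x (p 0%N) (p 1%N) (p 2%N) = 0].
    by split; apply: V0x; case: lines => -[l1 l2];
       solve [by constructor 1 | by constructor 2 | by constructor 3].
  by rewrite !subr0 addr0.
pose b i := a 0 (inord i).
have sum_b : b 0%N + b 1%N + b 2%N + b 3%N = 0.
  rewrite -[RHS]sum_a !big_ord_recl big_ord0 addr0 /b !addrA.
  by congr (a _ _ + a _ _ + a _ _ + a _ _); apply/val_inj; rewrite /= inordK.
have comb_b : b 0%N *: p 0%N + b 1%N *: p 1%N + b 2%N *: p 2%N + b 3%N *: p 3%N = 0.
  rewrite -[RHS]comb_a; apply/rowP => j; rewrite !mxE !big_ord_recl big_ord0 addr0 /b !addrA.
  by congr (a _ _ * S _ _ + a _ _ * S _ _ + a _ _ * S _ _ + a _ _ * S _ _);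
     apply/val_inj; rewrite /= inordK.
have nz : [\/ b 0%N != 0, b 1%N != 0, b 2%N != 0 | b 3%N != 0].
  have [b0|] := eqVneq (b 0%N) 0; last by constructor 1.
  have [b1|] := eqVneq (b 1%N) 0; last by constructor 2.
  have [b2|] := eqVneq (b 2%N) 0; last by constructor 3.
  constructor 4; apply: contra_neq a0 => b3; apply/rowP => i.
  have -> : a 0 i = b i by rewrite /b inord_val.
  by rewrite mxE; case: i => [[|[|[|[|]]]]].
case: (balanced_pairing sum_b nz) => h.
- have [x [Hx l1 l2]] := crossing_point Hconv (And4 (Hp 0) (Hp 1) (Hp 2) (Hp 3)) sum_b comb_b h.
  by apply: (key x Hx); constructor 1.
- have [||x [Hx l1 l2]] := crossing_point Hconv (And4 (Hp 0) (Hp 2) (Hp 1) (Hp 3)) _ _ h.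
  + by rewrite -[RHS]sum_b; ring.
  + by rewrite -[RHS]comb_b; apply/rowP => j; rewrite !mxE; ring.
  by apply: (key x Hx); constructor 2.
- have [||x [Hx l1 l2]] := crossing_point Hconv (And4 (Hp 0) (Hp 3) (Hp 1) (Hp 2)) _ _ h.
  + by rewrite -[RHS]sum_b; ring.
  + by rewrite -[RHS]comb_b; apply/rowP => j; rewrite !mxE; ring.
  by apply: (key x Hx); constructor 3.
Qed.

End ClosedOnPlanes.

(** * The theorem *)

(** Only the combinatorics of the subdivision and the closedness of its limits
    depend on k: the rest of the argument is common. *)
Lemma sewing_of_scheme (R : realType) (k : nat) (pieces fills : seq (seq (nat * nat)))
    (d : nat) (D : set 'rV[R]_d) (u : germ R k.+1 d) :
  size pieces = (2 ^ k)%N ->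
  (forall l, l \in pieces -> forall d (S : tuple_of R k d), exists e b,
    e ^+ 2 = 1 /\ forall i, row i (midpts k l S) = (e * 2^-1) *: row i S + b) ->
  (forall d D (w : germ R k d) S, simplex D S -> nonatomic D w ->
    `|w S - subdivide pieces w S| <= \sum_(l <- fills) `|delta w (midpts k.+1 l S)|) ->
  (forall w : germ R k d, nonatomic D w ->
    (forall S, simplex D S -> w S = subdivide pieces w S) -> coplanar_small D w ->
    closed_on_planes D w) ->
  strong_dini D k%:R u -> germ_continuous D u -> germ_continuous D (dini_sum k%:R u) ->
  exists v : germ R k d,
    [/\ germ_continuous D v, dini D k%:R v &
      forall w : germ R k d,
        germ_continuous D w -> nonatomic D w ->
        germ_approx D u (delta w) (fun=> 0) ->
        exists sew : germ R k d,
          [/\ is_sewing D v w sew, germ_continuous D sew &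
            (germ_seminorm D v (w \- sew)%R <= germ_seminorm D u (delta w))%E]].
Proof.
move=> sz half fill closed ud uc sc; exists (weight fills u); split.
- exact: weight_continuous.
- exact: weight_dini.
move=> w wc wna /ereal_inf_lt[_ [c [c0 wu] <-] _].
have dw (T : tuple_of R k.+1 d) : simplex D T -> `|delta w T| <= c * u T.
  by move=> DT; have := wu T DT; rewrite /= subr0.
exists (sew pieces w); split.
- split; last first.
    apply: le_lt_trans (ltry c); apply: ereal_inf_lbound; exists c => //; split=> // S DS.
    exact: (sew_dist sz half fill ud wna c0 dw DS).
  have na : nonatomic D (sew pieces w) by exact: sew_nonatomic.
  split=> //; apply: closed => //.
  + by move=> S DS; apply: (sew_subdivide sz half fill ud wna c0 dw).
  + by move=> S e DS e0; apply: (delta_sew_small sz half fill ud uc sc wna c0 dw).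
- exact: (sew_continuous sz half fill ud uc sc wc wna c0 dw).
- apply: ereal_inf_le_tmp => _ [b [b0 wb] <-]; exists b => //; split=> // S DS.
  exact: (sew_dist sz half fill ud wna b0 wb DS).
Qed.

Theorem theorem3p19 (R : realType) (d : nat) (D : set 'rV[R]_d) (k : nat)
    (hk : k = 1%N \/ k = 2%N) (u : germ R k.+1 d)
    (u_dini : strong_dini D k%:R u) (u_cont : germ_continuous D u)
    (usum_cont : germ_continuous D (dini_sum k%:R u)) :
  exists v : germ R k d,
    [/\ germ_continuous D v, dini D k%:R v &
      forall w : germ R k d,
        germ_continuous D w -> nonatomic D w ->
        germ_approx D u (delta w) (fun=> 0) ->
        exists sew : germ R k d,
          [/\ is_sewing D v w sew, germ_continuous D sew &
            (germ_seminorm D v (w \- sew)%R <= germ_seminorm D u (delta w))%E]].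
Proof.
case: hk => kE; subst k.
- apply: (@sewing_of_scheme R 1 pieces1 fills1) => //.
  + exact: pieces1_half.
  + by move=> d0 D0 w S DS na; apply: (defect1_le_fills DS na).
  + move=> w na inv small; apply: closed_on_lines => S M.
    exact: closed_on_segment.
- apply: (@sewing_of_scheme R 2 pieces2 fills2) => //.
  + exact: pieces2_half.
  + by move=> d0 D0 w S DS na; apply: (defect2_le_fills DS na).
  + move=> w na inv small; apply: closed_on_2planes => S M.
    exact: closed_on_triangle.
Qed.
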